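(* Assume $1<\gamma<2$ and $B_0\neq0$. Let $\overline\rho>0$ and $\overline B\in\mathbb{R}$ be two constants, and let $s\ge6$ be an integer. Then there exists a constant $\epsilon=\epsilon(\gamma,B_0,\overline\rho,\overline B,s)>0$ such that if the initial data $\rho_{t=0},B_{t=0}\in C^\infty(\mathbb{T})$ satisfy $$\|\rho_{t=0}-\overline\rho\|_{H^s}+\|B_{t=0}-\overline B\|_{H^s}\le\epsilon,\qquad \frac{1}{|\mathbb{T}|}\int_{\mathbb{T}}\rho_{t=0}\,dx=\overline\rho,\qquad \frac{1}{|\mathbb{T}|}\int_{\mathbb{T}}B_{t=0}\,dx=\overline B,$$ then the (unique, maximal) smooth solution $(\rho,B)$ of $$ \begin{cases} \partial_t\rho=\partial_x^2\left(\frac1\gamma\rho^\gamma+\frac12B^2\right),\\ \partial_tB=\partial_x\left(\frac{B}{\rho}\,\partial_x\left(\frac1\gamma\rho^\gamma+\frac12B^2\right)+\frac{B_0^2}{\rho}\,\partial_xB\right), \end{cases} \qquad (\rho,B)(0,\cdot)=(\rho_{t=0},B_{t=0}), $$ is global in time, and satisfies $$(\rho(t),B(t))\to(\overline\rho,\overline B)\quad\text{in }H^m(\mathbb{T})\text{ as }t\to\infty$$ for any nonnegative integer $m<s$. In particular, $u(t)\to0$ in $H^{m-1}(\mathbb{T})$ as $t\to\infty$, where $u=(u^x,u^y,u^z)$ is given by $$\rho u^x=-\rho^{\gamma-1}\partial_x\rho-B\,\partial_xB,\qquad \rho u^y=0,\qquad \rho u^z=B_0\,\partial_xB .$$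
   Context: $\mathbb{T}$ is the one-dimensional torus (a circle of fixed period, e.g. $\mathbb{R}/\mathbb{Z}$), of length $|\mathbb{T}|$. $B_0\in\mathbb{R}$ is a fixed constant; it is not the initial datum of $B$, which is denoted $B_{t=0}$. The unknowns $\rho,B$ are real-valued functions of $t\ge0$, $x\in\mathbb{T}$. For $1<\gamma<2$, $B_0\ne0$ and smooth initial data with $\rho_{t=0}>0$, the system has a unique smooth solution $(\rho,B)\in C^\infty([0,T)\times\mathbb{T})$ with $\rho>0$ on a maximal time interval $[0,T)$, $T\in(0,\infty]$, where $T<\infty$ implies $\lim_{t\to T-}(\|\rho(t)\|_{H^3}+\|B(t)\|_{H^3})=\infty$; this is the solution referred to in the claim (for $\epsilon$ small the data satisfy $\rho_{t=0}>0$), and ''global in time'' means $T=\infty$. $H^m=H^m(\mathbb{T})$ are the usual Sobolev spaces. *)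

(* Defs.v *)
(* Stdlib reals with Coquelicot.  The torus is the circle R/LZ with L > 0, and
   functions on it are L-periodic functions on R. *)
From Stdlib Require Import Reals ZArith.
From Coquelicot Require Import Coquelicot.
Open Scope R_scope.

Definition torus_periodic (L : R) (f : R -> R) : Prop :=
  forall x, f (x + L) = f x.

Definition torus_smooth (L : R) (f : R -> R) : Prop :=
  torus_periodic L f /\ forall (n : nat) (x : R), ex_derive_n f n x.

Definition torus_mean (L : R) (f : R -> R) : R := / L * RInt f 0 L.

(* The Sobolev norms are only used on smooth functions, where weak derivatives
   are the classical ones. *)
Definition sobolev_norm (L : R) (m : nat) (f : R -> R) : R :=
  sqrt (sum_n (fun k => RInt (fun x => (Derive_n f k x) ^ 2) 0 L) m).

(* H^{-k} is normed as the dual of H^k.  For continuous f the supremum is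
   finite (it is at most the L^2 norm of f), so [real] loses nothing. *)
Definition sobolev_dual_norm (L : R) (k : nat) (f : R -> R) : R :=
  real (Lub_Rbar (fun r => exists phi : R -> R,
    torus_smooth L phi /\ sobolev_norm L k phi <= 1 /\
    r = RInt (fun x => f x * phi x) 0 L)).

Definition Hnorm (L : R) (m : Z) (f : R -> R) : R :=
  match m with
  | Zneg p => sobolev_dual_norm L (Pos.to_nat p) f
  | _ => sobolev_norm L (Z.to_nat m) f
  end.
Arguments Hnorm L%_R m%_Z f.

Definition in_lifespan (T : Rbar) (t : R) : Prop :=
  0 <= t /\ Rbar_lt (Finite t) T.

(* C^infinity([0,T) x R), T possibly infinite: [d i j] is the partial derivative
   of order i in t and j in x.  All of them exist for 0 < t < T and are jointly
   continuous up to and including t = 0; values of f at times outside [0,T) are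
   irrelevant. *)
Definition smooth_on_lifespan (T : Rbar) (f : R -> R -> R) : Prop :=
  exists d : nat -> nat -> R -> R -> R,
    (forall t x, in_lifespan T t -> d 0%nat 0%nat t x = f t x) /\
    (forall i j t x, 0 < t -> Rbar_lt (Finite t) T ->
       is_derive (fun tau => d i j tau x) t (d (S i) j t x)) /\
    (forall i j t x, in_lifespan T t ->
       is_derive (fun y => d i j t y) x (d i (S j) t x)) /\
    (forall i j t x, in_lifespan T t ->
       filterlim (fun p : R * R => d i j (fst p) (snd p))
         (within (fun p : R * R => 0 <= fst p) (locally (t, x)))
         (locally (d i j t x))).

Definition total_pressure (gamma : R) (rho B : R -> R -> R) (t x : R) : R :=
  / gamma * Rpower (rho t x) gamma + / 2 * (B t x) ^ 2.

Definition rho_equation (gamma : R) (rho B : R -> R -> R) (t x : R) : Prop :=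
  Derive (fun tau => rho tau x) t
  = Derive_n (fun y => total_pressure gamma rho B t y) 2 x.

Definition B_equation (gamma B0 : R) (rho B : R -> R -> R) (t x : R) : Prop :=
  Derive (fun tau => B tau x) t
  = Derive (fun y =>
        B t y / rho t y * Derive (fun z => total_pressure gamma rho B t z) y
        + B0 ^ 2 / rho t y * Derive (fun z => B t z) y) x.

(* The equations are imposed for 0 < t < T, where [Derive] is the two-sided
   time derivative; at t = 0 they follow from smoothness up to t = 0. *)
Definition smooth_solution (L gamma B0 : R) (rho_init B_init : R -> R)
    (T : Rbar) (rho B : R -> R -> R) : Prop :=
  Rbar_lt (Finite 0) T /\
  smooth_on_lifespan T rho /\ smooth_on_lifespan T B /\
  (forall t, in_lifespan T t ->
     torus_periodic L (rho t) /\ torus_periodic L (B t)) /\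
  (forall t x, in_lifespan T t -> 0 < rho t x) /\
  (forall x, rho 0 x = rho_init x /\ B 0 x = B_init x) /\
  (forall t x, 0 < t -> Rbar_lt (Finite t) T ->
     rho_equation gamma rho B t x /\ B_equation gamma B0 rho B t x).

(* The maximal smooth solution extends every smooth solution with the same data.
   By the local well-posedness theory it exists for positive smooth data, and
   its H^3 norm blows up at T if T is finite; this blow-up criterion is taken as
   part of the notion. *)
Definition maximal_smooth_solution (L gamma B0 : R) (rho_init B_init : R -> R)
    (T : Rbar) (rho B : R -> R -> R) : Prop :=
  smooth_solution L gamma B0 rho_init B_init T rho B /\
  (forall T' rho' B',
     smooth_solution L gamma B0 rho_init B_init T' rho' B' ->
     Rbar_le T' T /\
     forall t x, in_lifespan T' t -> rho' t x = rho t x /\ B' t x = B t x) /\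
  (forall T0 : R, T = Finite T0 ->
     filterlim (fun t => Hnorm L 3 (rho t) + Hnorm L 3 (B t))
       (at_left T0) (Rbar_locally p_infty)).

Definition velocity (gamma B0 : R) (rho B ux uy uz : R -> R -> R)
    (t x : R) : Prop :=
  rho t x * ux t x
    = - Rpower (rho t x) (gamma - 1) * Derive (fun y => rho t y) x
      - B t x * Derive (fun y => B t y) x /\
  rho t x * uy t x = 0 /\
  rho t x * uz t x = B0 * Derive (fun y => B t y) x.

(* Main.v *)
Require Import Defs.
From Stdlib Require Import Reals ZArith.
From Coquelicot Require Import Coquelicot.
From Stdlib Require Import Lra Lia FunctionalExtensionality.
Open Scope R_scope.

(** In the deviations [r = rho - rhobar] and [b = B - Bbar] the system is a
    conservation law [U_t = (A(U) U_x)_x].  At the equilibrium the Hessian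
    [diag (rhobar ^ (gamma - 2), 1)] of the entropy makes [A] symmetric and
    positive definite, its determinant being a multiple of [B0 ^ 2].  Let [Y] be
    the square of the H^s norm of [(r, b)] and [Z] that of [(r_x, b_x)].  The sup
    norms of the derivatives of order at most [s - 1] are controlled by
    [N = sqrt (L * Y)], those of order [s] by [D = sqrt (L * Z)], and a Leibniz
    term never contains two factors of order [s]; hence the nonlinear terms in
    the H^s energy balance are [O(N Z)] and the energy satisfies
    [E' <= - c Z <= - c' E] as long as it is small.  Both means being conserved,
    the Poincare inequality bounds [E] by [Z].  A continuity argument propagates
    the smallness, which excludes blow-up and gives exponential decay. *)

(** * Calculus of smooth functions *)

(** The obstacle is that the balance at order s differentiates the coefficients s times, while H^s
    yields small sup norms only up to order s - 1. At order s nothing small is available; what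
    replaces smallness is that D^2 = L Z, so D can be absorbed by the dissipation itself. Hence
    every error must have the form N D |X| or N X^2, where X is a derivative of order up to s + 1
    that is kept in L^2 and never estimated pointwise. This is why each coefficient is compared with
    its constant value at the equilibrium: only that constant part is symmetrized, the energy keeps
    a constant weight, and all the rest is a perturbation carrying a factor N. No bound on D uniform
    in time is claimed; the conclusions use N alone. As N is the square root of a multiple of the
    energy, it decays at half the rate. It controls orders up to s - 1 of the deviations, hence H^m
    for m < s, and one order fewer of the velocity, which contains a first derivative. *)

Definition smooth (f : R -> R) : Prop := forall n x, ex_derive_n f n x.

(** [Derive_n] unfolds to an outermost derivative, whereas the inductions on products and powers
    differentiate the function itself first. *)
Lemma Derive_n_succ (f : R -> R) (n : nat) :
  Derive_n f (S n) = Derive_n (Derive f) n.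
Proof.
  apply functional_extensionality; intros x.
  replace (S n) with (n + 1)%nat by lia.
  symmetry; exact (Derive_n_comp f n 1 x).
Qed.

Lemma smooth_ex_derive (f : R -> R) (x : R) : smooth f -> ex_derive f x.
Proof. intros H; exact (H 1%nat x). Qed.

Lemma smooth_Derive (f : R -> R) : smooth f -> smooth (Derive f).
Proof.
  intros H [|n] x; [exact I|].
  simpl; rewrite <- Derive_n_succ; exact (H (S (S n)) x).
Qed.

Lemma smooth_Derive_n (f : R -> R) (k : nat) : smooth f -> smooth (Derive_n f k).
Proof.
  intros H; induction k as [|k IH]; [exact H|].
  exact (smooth_Derive _ IH).
Qed.

Lemma ex_derive_n_succ (f : R -> R) :
  (forall x, ex_derive f x) ->
  forall n, (forall x, ex_derive_n (Derive f) n x) -> forall x, ex_derive_n f (S n) x.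
Proof.
  intros H0 [|n] H x; [exact (H0 x)|].
  change (ex_derive (Derive_n f (S n)) x).
  rewrite Derive_n_succ; exact (H x).
Qed.

Lemma smooth_continuous (f : R -> R) (x : R) : smooth f -> continuous f x.
Proof. intros H; apply @ex_derive_continuous, smooth_ex_derive, H. Qed.

Lemma smooth_const (c : R) : smooth (fun _ => c).
Proof. intros n x; apply ex_derive_n_const. Qed.

Lemma smooth_plus (f g : R -> R) :
  smooth f -> smooth g -> smooth (fun x => f x + g x).
Proof.
  intros Hf Hg n x; apply ex_derive_n_plus; apply filter_forall; intros y k _.
  - apply Hf.
  - apply Hg.
Qed.

Lemma Derive_n_plus_smooth (f g : R -> R) (n : nat) :
  smooth f -> smooth g ->
  Derive_n (fun x => f x + g x) n = fun x => Derive_n f n x + Derive_n g n x.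
Proof.
  intros Hf Hg; apply functional_extensionality; intros x.
  apply Derive_n_plus; apply filter_forall; intros y k _.
  - apply Hf.
  - apply Hg.
Qed.

Lemma smooth_scal (c : R) (f : R -> R) : smooth f -> smooth (fun x => c * f x).
Proof. intros Hf n x; apply ex_derive_n_scal_l, Hf. Qed.

Lemma Derive_n_scal_smooth (c : R) (f : R -> R) (n : nat) :
  Derive_n (fun x => c * f x) n = fun x => c * Derive_n f n x.
Proof. apply functional_extensionality; intros x; apply Derive_n_scal_l. Qed.

Lemma Derive_plus_const (c : R) (f : R -> R) :
  Derive (fun x => c + f x) = Derive f.
Proof.
  apply functional_extensionality; intros x; unfold Derive; f_equal.
  apply Lim_ext; intros h; f_equal; ring.
Qed.

Lemma Derive_mult_smooth (f g : R -> R) :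
  smooth f -> smooth g ->
  Derive (fun x => f x * g x) = fun x => Derive f x * g x + f x * Derive g x.
Proof.
  intros Hf Hg; apply functional_extensionality; intros x.
  apply Derive_mult; apply smooth_ex_derive; assumption.
Qed.

Lemma smooth_mult (f g : R -> R) :
  smooth f -> smooth g -> smooth (fun x => f x * g x).
Proof.
  revert f g.
  (* All orders m <= n are carried along because the sum rule for [ex_derive_n] asks for every lower
     order near the point. *)
  assert (K : forall n f g, smooth f -> smooth g ->
    forall m, (m <= n)%nat -> forall x, ex_derive_n (fun x => f x * g x) m x).
  { intros n; induction n as [|n IH]; intros f g Hf Hg m Hm x.
    - replace m with 0%nat by lia; exact I.
    - destruct m as [|m]; [exact I|].
      apply ex_derive_n_succ.
      + intros y; apply ex_derive_mult; apply smooth_ex_derive; assumption.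
      + intros y; rewrite Derive_mult_smooth by assumption.
        apply ex_derive_n_plus; apply filter_forall; intros z k Hk;
          apply IH; try lia; try assumption; apply smooth_Derive; assumption. }
  intros f g Hf Hg n x; apply (K n f g Hf Hg n (Nat.le_refl n)).
Qed.

Lemma is_derive_Rpower (a u : R) :
  0 < u -> is_derive (fun y => Rpower y a) u (a * Rpower u (a - 1)).
Proof. intros Hu; apply is_derive_Reals, derivable_pt_lim_power, Hu. Qed.

Lemma Derive_Rpower_smooth (a : R) (f : R -> R) :
  smooth f -> (forall x, 0 < f x) ->
  Derive (fun x => Rpower (f x) a)
  = fun x => a * (Rpower (f x) (a - 1) * Derive f x).
Proof.
  intros Hf Hp; apply functional_extensionality; intros x.
  apply is_derive_unique.
  replace (a * (Rpower (f x) (a - 1) * Derive f x))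
    with (scal (Derive f x) (a * Rpower (f x) (a - 1)))
    by (unfold scal; simpl; unfold mult; simpl; ring).
  apply (is_derive_comp (fun y => Rpower y a) f).
  - apply is_derive_Rpower, Hp.
  - apply Derive_correct, smooth_ex_derive, Hf.
Qed.

Lemma ex_derive_Rpower (a : R) (f : R -> R) (x : R) :
  smooth f -> (forall x, 0 < f x) -> ex_derive (fun x => Rpower (f x) a) x.
Proof.
  intros Hf Hp; apply (ex_derive_comp (fun y => Rpower y a) f).
  - eexists; apply is_derive_Rpower, Hp.
  - apply smooth_ex_derive, Hf.
Qed.

Lemma smooth_Rpower (a : R) (f : R -> R) :
  smooth f -> (forall x, 0 < f x) -> smooth (fun x => Rpower (f x) a).
Proof.
  intros Hf Hp.
  (* Products of a power of f and a smooth g are stable under differentiation up to sums, with the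
     exponent possibly lowered by one; hence the induction runs over all g and all exponents. *)
  assert (K : forall n g a, smooth g -> forall m, (m <= n)%nat ->
     forall x, ex_derive_n (fun x => Rpower (f x) a * g x) m x).
  { intros n; induction n as [|n IH]; intros g b Hg m Hm x.
    - replace m with 0%nat by lia; exact I.
    - destruct m as [|m]; [exact I|].
      apply ex_derive_n_succ.
      + intros y; apply ex_derive_mult.
        * apply ex_derive_Rpower; assumption.
        * apply smooth_ex_derive; assumption.
      + intros y.
        replace (Derive (fun x => Rpower (f x) b * g x)) with
          (fun x => Rpower (f x) (b - 1) * (b * (Derive f x * g x))
                    + Rpower (f x) b * Derive g x).
        * apply ex_derive_n_plus; apply filter_forall; intros z k Hk;
            apply IH; try lia.
          -- apply smooth_scal, smooth_mult; [apply smooth_Derive|]; assumption.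
          -- apply smooth_Derive; assumption.
        * apply functional_extensionality; intros z.
          rewrite Derive_mult; [|apply ex_derive_Rpower; assumption
                                |apply smooth_ex_derive; assumption].
          rewrite Derive_Rpower_smooth by assumption; ring. }
  intros n x.
  replace (fun x => Rpower (f x) a) with (fun x => Rpower (f x) a * 1)
    by (apply functional_extensionality; intros; ring).
  apply (K n (fun _ => 1) a (smooth_const 1) n (Nat.le_refl n)).
Qed.

Ltac smooth_tac :=
  match goal with
  | H : smooth ?f |- smooth ?f => exact H
  | |- smooth (Derive _) => apply smooth_Derive; smooth_tac
  | |- smooth (Derive_n _ _) => apply smooth_Derive_n; smooth_tac
  | |- smooth (fun _ => ?c) => exact (smooth_const c)
  | |- smooth (fun x => Rpower (@?f x) _) =>
      apply (smooth_Rpower _ f); [smooth_tac|try assumption]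
  | |- smooth (fun x => ?c * @?g x) => apply (smooth_scal c g); smooth_tac
  | |- smooth (fun x => @?f x + @?g x) => apply (smooth_plus f g); smooth_tac
  | |- smooth (fun x => @?f x * @?g x) => apply (smooth_mult f g); smooth_tac
  | |- smooth (fun x => ?f x) => change (smooth f); smooth_tac
  end.

(** * Pointwise product estimates for derivatives *)

Lemma leibniz_bound (n : nat) : forall (f g : R -> R) (x M : R),
  smooth f -> smooth g ->
  (forall j, (j <= n)%nat -> Rabs (Derive_n f j x * Derive_n g (n - j) x) <= M) ->
  Rabs (Derive_n (fun x => f x * g x) n x) <= 2 ^ n * M.
Proof.
  induction n as [|n IH]; intros f g x M Hf Hg H.
  - specialize (H 0%nat (Nat.le_refl 0)); simpl in *; lra.
  - rewrite Derive_n_succ, Derive_mult_smooth by assumption.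
    rewrite Derive_n_plus_smooth
      by smooth_tac.
    assert (H1 := IH (Derive f) g x M (smooth_Derive _ Hf) Hg).
    assert (H2 := IH f (Derive g) x M Hf (smooth_Derive _ Hg)).
    eapply Rle_trans; [apply Rabs_triang|].
    (* Each differentiation doubles the number of Leibniz terms, all of which obey the same bound
       [M]; counting them replaces binomial coefficients. *)
    replace (2 ^ S n * M) with (2 ^ n * M + 2 ^ n * M) by (simpl; ring).
    apply Rplus_le_compat; [apply H1|apply H2]; intros j Hj; rewrite <- Derive_n_succ.
    + exact (H (S j) ltac:(lia)).
    + replace (S (n - j)) with (S n - j)%nat by lia; apply H; lia.
Qed.

(** The term left out has all n derivatives on g. With g = w' it is the only one containing the
    order n + 1 of w, which at the top order has no sup bound; in all others f is differentiated at
    least once. *)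
Lemma commutator_bound (n : nat) : forall (f g : R -> R) (x M : R),
  smooth f -> smooth g -> 0 <= M ->
  (forall j, (1 <= j <= n)%nat -> Rabs (Derive_n f j x * Derive_n g (n - j) x) <= M) ->
  Rabs (Derive_n (fun x => f x * g x) n x - f x * Derive_n g n x) <= 2 ^ n * M.
Proof.
  induction n as [|n IH]; intros f g x M Hf Hg HM H.
  - simpl; rewrite Rminus_diag, Rabs_R0; lra.
  - rewrite !Derive_n_succ, Derive_mult_smooth by assumption.
    rewrite Derive_n_plus_smooth
      by smooth_tac.
    assert (H1 := leibniz_bound n (Derive f) g x M (smooth_Derive _ Hf) Hg).
    assert (H2 := IH f (Derive g) x M Hf (smooth_Derive _ Hg) HM).
    (* The half with f' g is a full Leibniz sum; the half with f g' keeps the subtracted term and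
       falls under the induction hypothesis. *)
    unfold Rminus; rewrite Rplus_assoc.
    eapply Rle_trans; [apply Rabs_triang|].
    replace (2 ^ S n * M) with (2 ^ n * M + 2 ^ n * M) by (simpl; ring).
    apply Rplus_le_compat; [apply H1|apply H2]; intros j Hj; rewrite <- Derive_n_succ.
    + exact (H (S j) ltac:(lia)).
    + replace (S (n - j)) with (S n - j)%nat by lia; apply H; lia.
Qed.

Definition dbound (n : nat) (M : R) (f : R -> R) : Prop :=
  forall j x, (j <= n)%nat -> Rabs (Derive_n f j x) <= M.

Lemma dbound_le (n m : nat) (M M' : R) (f : R -> R) :
  (m <= n)%nat -> M <= M' -> dbound n M f -> dbound m M' f.
Proof. intros H1 H2 H j x Hj; eapply Rle_trans; [apply H; lia|exact H2]. Qed.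

Lemma dbound_plus (n : nat) (M M' : R) (f g : R -> R) :
  smooth f -> smooth g -> dbound n M f -> dbound n M' g ->
  dbound n (M + M') (fun x => f x + g x).
Proof.
  intros Sf Sg Hf Hg j x Hj; rewrite Derive_n_plus_smooth by assumption.
  eapply Rle_trans; [apply Rabs_triang|].
  apply Rplus_le_compat; [apply Hf|apply Hg]; exact Hj.
Qed.

Lemma dbound_scal (n : nat) (c M : R) (f : R -> R) :
  dbound n M f -> dbound n (Rabs c * M) (fun x => c * f x).
Proof.
  intros Hf j x Hj; rewrite Derive_n_scal_smooth, Rabs_mult.
  apply Rmult_le_compat_l; [apply Rabs_pos|apply Hf, Hj].
Qed.

Lemma dbound_Derive (n : nat) (M : R) (f : R -> R) :
  dbound (S n) M f -> dbound n M (Derive f).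
Proof. intros Hf j x Hj; rewrite <- Derive_n_succ; apply Hf; lia. Qed.

Lemma dbound_succ (n : nat) (M : R) (f : R -> R) :
  (forall x, Rabs (f x) <= M) -> dbound n M (Derive f) -> dbound (S n) M f.
Proof.
  intros H0 H [|j] x Hj; [apply H0|].
  rewrite Derive_n_succ; apply H; lia.
Qed.

Lemma dbound_nonneg (n : nat) (M : R) (f : R -> R) : dbound n M f -> 0 <= M.
Proof.
  intros H; eapply Rle_trans; [apply Rabs_pos|apply (H 0%nat 0); lia].
Qed.

Lemma dbound_mult (n : nat) (M M' : R) (f g : R -> R) :
  smooth f -> smooth g -> dbound n M f -> dbound n M' g ->
  dbound n (2 ^ n * (M * M')) (fun x => f x * g x).
Proof.
  intros Sf Sg Hf Hg j x Hj.
  assert (HM := dbound_nonneg _ _ _ Hf); assert (HM' := dbound_nonneg _ _ _ Hg).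
  eapply Rle_trans.
  - apply (leibniz_bound j f g x (M * M') Sf Sg); intros i Hi.
    rewrite Rabs_mult; apply Rmult_le_compat; try apply Rabs_pos.
    + apply Hf; lia.
    + apply Hg; lia.
  - apply Rmult_le_compat_r; [apply Rmult_le_pos; assumption|].
    apply Rle_pow; [lra|exact Hj].
Qed.

(* Two factors whose orders add up to at most [p + 1] are not both of order
   [p + 1], so only one of them has to pay the weak bound [D]. *)
Lemma dbound_mult_tame (p : nat) (N D K K' : R) (f g : R -> R) :
  smooth f -> smooth g -> 0 <= N <= 1 -> 0 <= K -> 0 <= K' -> 0 <= D ->
  dbound p (K * N) f -> dbound (S p) (K * D) f ->
  dbound p (K' * N) g -> dbound (S p) (K' * D) g ->
  dbound p (2 ^ S p * (K * K') * N) (fun x => f x * g x) /\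
  dbound (S p) (2 ^ S p * (K * K') * D) (fun x => f x * g x).
Proof.
  intros Sf Sg HN HK HK' HD Hf1 Hf2 Hg1 Hg2.
  assert (HKK : 0 <= K * K') by (apply Rmult_le_pos; assumption).
  split.
  - eapply dbound_le; [apply Nat.le_refl| |apply (dbound_mult p _ _ f g Sf Sg Hf1 Hg1)].
    assert (H : 0 < 2 ^ p) by (apply pow_lt; lra).
    replace (2 ^ p * (K * N * (K' * N))) with (2 ^ p * (K * K' * N * N)) by ring.
    replace (2 ^ S p * (K * K') * N) with (2 ^ p * (2 * (K * K' * N))) by (simpl; ring).
    apply Rmult_le_compat_l; [lra|].
    assert (0 <= K * K' * N) by (apply Rmult_le_pos; lra).
    assert (0 <= K * K' * N * (1 - N)) by (apply Rmult_le_pos; lra).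
    nra.
  - intros j x Hj.
    assert (HT : 0 <= K * K' * D) by (apply Rmult_le_pos; lra).
    eapply Rle_trans.
    + apply (leibniz_bound j f g x (K * K' * D) Sf Sg); intros i Hi.
      rewrite Rabs_mult.
      assert (HND : K * K' * D * N <= K * K' * D) by nra.
      destruct (Nat.le_gt_cases i p) as [Hip|Hip].
      * eapply Rle_trans; [apply Rmult_le_compat; try apply Rabs_pos;
          [apply Hf1, Hip|apply Hg2; lia]|nra].
      * eapply Rle_trans; [apply Rmult_le_compat; try apply Rabs_pos;
          [apply Hf2; lia|apply Hg1; lia]|nra].
    + replace (2 ^ S p * (K * K') * D) with (2 ^ S p * (K * K' * D)) by ring.
      apply Rmult_le_compat_r; [exact HT|].
      apply Rle_pow; [lra|exact Hj].
Qed.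

(** * Tame bounds for the diffusion coefficients *)

Lemma Rpower_bounded (rhobar a : R) :
  0 < rhobar -> exists K, 0 <= K /\
  forall u, rhobar / 2 <= u <= 3 * rhobar / 2 -> Rabs (Rpower u a) <= K.
Proof.
  intros H0.
  (* Powers are monotone in u, in a direction given by the sign of a; the sum of the two end values
     covers both. *)
  exists (exp (a * ln (rhobar / 2)) + exp (a * ln (3 * rhobar / 2))).
  assert (P1 := exp_pos (a * ln (rhobar / 2))).
  assert (P2 := exp_pos (a * ln (3 * rhobar / 2))).
  split; [lra|]; intros u Hu; unfold Rpower.
  rewrite Rabs_pos_eq by (apply Rlt_le, exp_pos).
  assert (L1 : ln (rhobar / 2) <= ln u) by (apply ln_le; lra).
  assert (L2 : ln u <= ln (3 * rhobar / 2)) by (apply ln_le; lra).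
  assert (EL : forall y z, y <= z -> exp y <= exp z).
  { intros y z [h|h]; [apply Rlt_le, exp_increasing, h|rewrite h; lra]. }
  destruct (Rle_dec 0 a) as [Ha|Ha].
  - assert (exp (a * ln u) <= exp (a * ln (3 * rhobar / 2))) by (apply EL; nra); lra.
  - assert (exp (a * ln u) <= exp (a * ln (rhobar / 2))) by (apply EL; nra); lra.
Qed.

Lemma Rpower_lipschitz (rhobar a : R) :
  0 < rhobar -> exists K, 0 <= K /\
  forall h, Rabs h <= rhobar / 2 ->
    Rabs (- Rpower rhobar a + Rpower (rhobar + h) a) <= K * Rabs h.
Proof.
  intros H0; destruct (Rpower_bounded rhobar (a - 1) H0) as [K [HK HB]].
  exists (Rabs a * K); split; [apply Rmult_le_pos; [apply Rabs_pos|exact HK]|].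
  intros h Hh; apply Rabs_le_between in Hh.
  destruct (MVT_gen (fun y => Rpower y a) rhobar (rhobar + h)
              (fun y => a * Rpower y (a - 1))) as [c [Hc E]].
  - intros y Hy; apply is_derive_Rpower.
    apply Rlt_trans with (2 := proj1 Hy), Rmin_glb_lt; lra.
  - intros y Hy; apply derivable_continuous_pt.
    exists (a * Rpower y (a - 1)); apply derivable_pt_lim_power.
    apply Rlt_le_trans with (2 := proj1 Hy), Rmin_glb_lt; lra.
  - replace (- Rpower rhobar a + Rpower (rhobar + h) a)
      with (a * Rpower c (a - 1) * h) by (rewrite <- (Rplus_minus_l rhobar h) at 1; lra).
    rewrite !Rabs_mult; apply Rmult_le_compat_r; [apply Rabs_pos|].
    apply Rmult_le_compat_l; [apply Rabs_pos|]; apply HB.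
    revert Hc; unfold Rmin, Rmax; destruct (Rle_dec rhobar (rhobar + h)); lra.
Qed.

(** Plain boundedness, meant for the factor of exponent a - 1 in the derivative of a power; the
    smallness will come from the other factor, [Derive r]. The induction needs all exponents at
    once, since differentiation lowers them. *)
Lemma dbound_Rpower (rhobar : R) (p : nat) :
  0 < rhobar -> forall a, exists K, 0 <= K /\
  forall r, smooth r -> (forall x, Rabs (r x) <= rhobar / 2) -> dbound p 1 r ->
    dbound p K (fun x => Rpower (rhobar + r x) a).
Proof.
  intros H0; induction p as [|p IH]; intros a;
    destruct (Rpower_bounded rhobar a H0) as [K0 [HK0 HB0]].
  - exists K0; split; [exact HK0|]; intros r Sr Hr Hd j x Hj.
    replace j with 0%nat by lia; apply HB0.
    specialize (Hr x); apply Rabs_le_between in Hr; lra.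
  - destruct (IH (a - 1)) as [K1 [HK1 HB1]].
    exists (K0 + Rabs a * (2 ^ p * (K1 * 1))).
    assert (HP : 0 <= Rabs a * (2 ^ p * (K1 * 1))).
    { apply Rmult_le_pos; [apply Rabs_pos|].
      apply Rmult_le_pos; [apply pow_le|]; lra. }
    split; [lra|]; intros r Sr Hr Hd.
    assert (Pos : forall x, 0 < rhobar + r x).
    { intros x; specialize (Hr x); apply Rabs_le_between in Hr; lra. }
    assert (Sr' : smooth (fun x => rhobar + r x)) by smooth_tac.
    apply dbound_succ.
    + intros x; eapply Rle_trans; [apply HB0|lra].
      specialize (Hr x); apply Rabs_le_between in Hr; lra.
    + rewrite Derive_Rpower_smooth, Derive_plus_const by assumption.
      eapply dbound_le with (n := p); [lia| |apply dbound_scal, dbound_mult].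
      * apply Rplus_le_reg_l with (- (Rabs a * (2 ^ p * (K1 * 1)))); rewrite Rplus_opp_l.
        replace (- (Rabs a * (2 ^ p * (K1 * 1))) + (K0 + Rabs a * (2 ^ p * (K1 * 1))))
          with K0 by ring; exact HK0.
      * smooth_tac.
      * smooth_tac.
      * apply HB1; try assumption.
        apply dbound_le with (3 := Hd); [lia|lra].
      * apply dbound_Derive, Hd.
Qed.

(* Derivatives up to order [p] are of size [N] (small), those of order [p + 1]
   only of size [D], the dissipation. *)
Definition near (p : nat) (rhobar N D : R) (r b : R -> R) : Prop :=
  0 <= N <= 1 /\ N <= rhobar / 2 /\ 0 <= D /\ smooth r /\ smooth b /\
  dbound p N r /\ dbound (S p) D r /\ dbound p N b /\ dbound (S p) D b.

(** The deviation from the equilibrium value inherits the two scales of [near]. It is written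
    [- fbar + f x] so that [Derive_plus_const] removes the constant. *)
Definition tame (p : nat) (N D K fbar : R) (f : R -> R) : Prop :=
  smooth f /\ dbound p (K * N) (fun x => - fbar + f x) /\
  dbound (S p) (K * D) (fun x => - fbar + f x).

(** [K] is uniform in the pair (r, b) and in both scales. The class is closed under sums and
    products, so the coefficients of the fluxes and of the velocity are assembled from powers of the
    density, [Bbar + b] and constants. *)
Definition admissible (p : nat) (rhobar fbar : R)
    (F : (R -> R) -> (R -> R) -> R -> R) : Prop :=
  exists K, 0 <= K /\
  forall N D r b, near p rhobar N D r b -> tame p N D K fbar (F r b).

Lemma near_pos (p : nat) (rhobar N D : R) (r b : R -> R) :
  0 < rhobar -> near p rhobar N D r b ->
  forall x, Rabs (r x) <= rhobar / 2 /\ 0 < rhobar + r x.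
Proof.
  intros H0 (HN & HN' & HD & Sr & Sb & Hr & _) x.
  assert (H := Hr 0%nat x (Nat.le_0_l p)); simpl in H.
  split; [lra|]; apply Rabs_le_between in H; lra.
Qed.

Lemma admissible_Rpower (p : nat) (rhobar a : R) :
  0 < rhobar ->
  admissible p rhobar (Rpower rhobar a) (fun r _ x => Rpower (rhobar + r x) a).
Proof.
  intros H0.
  destruct (dbound_Rpower rhobar p H0 (a - 1)) as [K1 [HK1 HB1]].
  destruct (Rpower_lipschitz rhobar a H0) as [K0 [HK0 HB0]].
  assert (H2p : 0 <= 2 ^ p) by (apply pow_le; lra).
  assert (HP : 0 <= Rabs a * (2 ^ p * K1)).
  { apply Rmult_le_pos; [apply Rabs_pos|apply Rmult_le_pos; assumption]. }
  exists (K0 + Rabs a * (2 ^ p * K1)); split; [lra|].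
  intros N D r b Hn.
  assert (Hpos := near_pos _ _ _ _ _ _ H0 Hn).
  destruct Hn as (HN & HN' & HD & Sr & Sb & Hr & Hr' & _).
  assert (Pos : forall x, 0 < rhobar + r x) by (intros; apply Hpos).
  assert (Sr' : smooth (fun x => rhobar + r x)) by smooth_tac.
  assert (Val : forall M, 0 <= M -> (forall x, Rabs (r x) <= M) -> forall x,
    Rabs (- Rpower rhobar a + Rpower (rhobar + r x) a)
      <= (K0 + Rabs a * (2 ^ p * K1)) * M).
  { intros M HM Hx x; eapply Rle_trans; [apply HB0, Hpos|].
    assert (K0 * Rabs (r x) <= K0 * M) by (apply Rmult_le_compat_l; auto).
    assert (0 <= Rabs a * (2 ^ p * K1) * M) by (apply Rmult_le_pos; auto); lra. }
  (* One argument serves twice: M = N at order p and M = D at order p + 1. In both cases the power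
     factor only needs r bounded by 1 up to order p, and [Derive r] supplies M. *)
  assert (Der : forall q M, (q <= p)%nat -> 0 <= M -> dbound (S q) M r ->
    dbound (S q) ((K0 + Rabs a * (2 ^ p * K1)) * M)
      (fun x => - Rpower rhobar a + Rpower (rhobar + r x) a)).
  { intros q M Hq HM Hd; apply dbound_succ.
    - apply Val; [exact HM|]; intros x; apply (Hd 0%nat x); lia.
    - rewrite Derive_plus_const, Derive_Rpower_smooth, Derive_plus_const by assumption.
      eapply dbound_le with (n := q); [lia| |apply dbound_scal, dbound_mult].
      + apply Rle_trans with (Rabs a * (2 ^ p * (K1 * M))).
        * apply Rmult_le_compat_l; [apply Rabs_pos|].
          apply Rmult_le_compat_r; [apply Rmult_le_pos; assumption|].
          apply Rle_pow; [lra|exact Hq].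
        * assert (0 <= K0 * M) by (apply Rmult_le_pos; assumption).
          replace (Rabs a * (2 ^ p * (K1 * M))) with (Rabs a * (2 ^ p * K1) * M) by ring.
          lra.
      + smooth_tac.
      + smooth_tac.
      + apply dbound_le with p K1; [lia|lra|].
        apply HB1; [assumption|apply Hpos|].
        apply dbound_le with (3 := Hr); [lia|lra].
      + apply dbound_Derive, Hd. }
  split; [smooth_tac|split].
  (* [Der] yields positive orders S q only, so p = 0 relies on the Lipschitz bound alone. *)
  - destruct p as [|q].
    + intros j x Hj; replace j with 0%nat by lia; apply Val; [lra|].
      intros y; apply (Hr 0%nat y); lia.
    + apply Der; [lia|lra|exact Hr].
  - apply Der; [lia|lra|exact Hr'].
Qed.

Lemma dbound_const (n : nat) (c : R) : dbound n (Rabs c) (fun _ => c).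
Proof.
  intros [|j] x _; [apply Rle_refl|].
  rewrite Derive_n_const, Rabs_R0; apply Rabs_pos.
Qed.

Lemma admissible_const (p : nat) (rhobar c : R) :
  admissible p rhobar c (fun _ _ _ => c).
Proof.
  exists 0; split; [lra|]; intros N D r b _.
  assert (H : forall n M, dbound n (0 * M) (fun _ => - c + c)).
  { intros n M; replace (0 * M) with (Rabs (- c + c))
      by (rewrite Rplus_opp_l, Rabs_R0; ring).
    apply dbound_const. }
  split; [apply smooth_const|split; apply H].
Qed.

Lemma admissible_B (p : nat) (rhobar Bbar : R) :
  admissible p rhobar Bbar (fun _ b x => Bbar + b x).
Proof.
  exists 1; split; [lra|]; intros N D r b (HN & HN' & HD & Sr & Sb & _ & _ & H1 & H2).
  split; [smooth_tac|].
  replace (fun x => - Bbar + (Bbar + b x)) with b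
    by (apply functional_extensionality; intros; ring).
  rewrite !Rmult_1_l; split; assumption.
Qed.

Lemma admissible_plus (p : nat) (rhobar fbar gbar : R) F G :
  admissible p rhobar fbar F -> admissible p rhobar gbar G ->
  admissible p rhobar (fbar + gbar) (fun r b x => F r b x + G r b x).
Proof.
  intros (K & HK & HF) (K' & HK' & HG).
  exists (K + K'); split; [lra|]; intros N D r b Hn.
  destruct (HF N D r b Hn) as (Sf & F1 & F2).
  destruct (HG N D r b Hn) as (Sg & G1 & G2).
  split; [exact (smooth_plus _ _ Sf Sg)|].
  replace (fun x => - (fbar + gbar) + (F r b x + G r b x))
    with (fun x => (- fbar + F r b x) + (- gbar + G r b x))
    by (apply functional_extensionality; intros; ring).
  rewrite !Rmult_plus_distr_r.
  split; apply dbound_plus; try assumption; smooth_tac.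
Qed.

Lemma admissible_mult (p : nat) (rhobar fbar gbar : R) F G :
  admissible p rhobar fbar F -> admissible p rhobar gbar G ->
  admissible p rhobar (fbar * gbar) (fun r b x => F r b x * G r b x).
Proof.
  intros (K & HK & HF) (K' & HK' & HG).
  assert (HP : 0 <= 2 ^ S p * (K * K')).
  { apply Rmult_le_pos; [apply pow_le; lra|apply Rmult_le_pos; assumption]. }
  exists (2 ^ S p * (K * K') + (Rabs fbar * K' + Rabs gbar * K)); split.
  { assert (0 <= Rabs fbar * K') by (apply Rmult_le_pos; [apply Rabs_pos|assumption]).
    assert (0 <= Rabs gbar * K) by (apply Rmult_le_pos; [apply Rabs_pos|assumption]).
    lra. }
  intros N D r b Hn.
  destruct (HF N D r b Hn) as (Sf & F1 & F2).
  destruct (HG N D r b Hn) as (Sg & G1 & G2).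
  destruct Hn as (HN & _ & HD & _).
  split; [exact (smooth_mult _ _ Sf Sg)|].
  set (phi := fun x => - fbar + F r b x) in *.
  set (psi := fun x => - gbar + G r b x) in *.
  assert (Sphi : smooth phi) by (unfold phi; smooth_tac).
  assert (Spsi : smooth psi) by (unfold psi; smooth_tac).
  (* With f = fbar + phi and g = gbar + psi, the deviation of fg is phi psi + fbar psi + gbar phi: a
     quadratic part for the tame product estimate and a linear rest. *)
  replace (fun x => - (fbar * gbar) + F r b x * G r b x)
    with (fun x => phi x * psi x + (fbar * psi x + gbar * phi x))
    by (apply functional_extensionality; intros; unfold phi, psi; ring).
  destruct (dbound_mult_tame p N D K K' phi psi Sphi Spsi HN HK HK' HD F1 F2 G1 G2)
    as [P1 P2].
  rewrite !Rmult_plus_distr_r, !(Rmult_assoc (Rabs _)).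
  split; repeat apply dbound_plus; try assumption; try smooth_tac;
    apply dbound_scal; assumption.
Qed.

Lemma dbound_admissible (p : nat) (rhobar fbar : R) F :
  admissible p rhobar fbar F ->
  exists M, 0 <= M /\ forall N D r b, near p rhobar N D r b ->
    smooth (F r b) /\ dbound p M (F r b).
Proof.
  intros (K & HK & HF); exists (Rabs fbar + K); split.
  { assert (H := Rabs_pos fbar); lra. }
  intros N D r b Hn; destruct (HF N D r b Hn) as (Sf & F1 & _).
  split; [exact Sf|].
  replace (F r b) with (fun x => fbar + (- fbar + F r b x))
    by (apply functional_extensionality; intros; ring).
  apply dbound_plus; [smooth_tac|smooth_tac| |].
  - apply dbound_const.
  - apply dbound_le with (3 := F1); [lia|].
    destruct Hn as (HN & _); nra.
Qed.

(** Only the deviation phi of the coefficient from [fbar] produces an error. Its top term, phi times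
    the order k + 1 of w, is kept as N times a pointwise value, to be integrated in L^2 later; every
    other term pairs one small factor with D. *)
Lemma flux_term_bound (p : nat) (rhobar fbar : R) F :
  (1 <= p)%nat -> admissible p rhobar fbar F ->
  exists C, 0 <= C /\ forall N D r b, near p rhobar N D r b ->
    forall w, smooth w -> dbound p N w -> dbound (S p) D w ->
    forall k x, (k <= S p)%nat ->
    Rabs (Derive_n (fun x => F r b x * Derive w x) k x - fbar * Derive_n w (S k) x)
      <= C * N * (D + Rabs (Derive_n w (S k) x)).
Proof.
  intros Hp (K & HK & HF).
  assert (H2p : 1 <= 2 ^ S p) by (apply pow_R1_Rle; lra).
  exists (2 ^ S p * K); split; [apply Rmult_le_pos; lra|].
  intros N D r b Hn w Sw W1 W2 k x Hk.
  destruct (HF N D r b Hn) as (Sf & F1 & F2); destruct Hn as (HN & _ & HD & _).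
  set (phi := fun x => - fbar + F r b x) in *.
  assert (Sphi : smooth phi) by (unfold phi; smooth_tac).
  replace (fun x => F r b x * Derive w x)
    with (fun x => fbar * Derive w x + phi x * Derive w x)
    by (apply functional_extensionality; intros; unfold phi; ring).
  rewrite Derive_n_plus_smooth by smooth_tac.
  rewrite Derive_n_scal_smooth, <- Derive_n_succ.
  assert (HKN : 0 <= K * N) by nra.
  assert (HKND : 0 <= K * N * D) by (apply Rmult_le_pos; lra).
  assert (C := commutator_bound k phi (Derive w) x (K * N * D) Sphi (smooth_Derive _ Sw) HKND).
  rewrite <- Derive_n_succ in C.
  set (X := Derive_n (fun x => phi x * Derive w x) k x) in *.
  set (W := Derive_n w (S k) x) in *.
  replace (fbar * W + X - fbar * W) with ((X - phi x * W) + phi x * W) by ring.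
  eapply Rle_trans; [apply Rabs_triang|].
  rewrite Rabs_mult, Rmult_plus_distr_l.
  apply Rplus_le_compat.
  - eapply Rle_trans; [apply C|].
    + intros j Hj; rewrite Rabs_mult, <- Derive_n_succ.
      destruct (Nat.le_gt_cases j p) as [Hjp|Hjp].
      * apply Rmult_le_compat; try apply Rabs_pos; [apply F1, Hjp|apply W2; lia].
      (* Here j = k = p + 1, so w is differentiated exactly once, and 1 <= p puts that factor under
         the small bound. *)
      * replace (K * N * D) with (K * D * N) by ring.
        apply Rmult_le_compat; try apply Rabs_pos; [apply F2; lia|apply W1; lia].
    + replace (2 ^ S p * K * N * D) with (2 ^ S p * (K * N * D)) by ring.
      apply Rmult_le_compat_r; [exact HKND|apply Rle_pow; [lra|exact Hk]].
  - apply Rmult_le_compat_r; [apply Rabs_pos|].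
    eapply Rle_trans; [apply (F1 0%nat x); lia|].
    rewrite Rmult_assoc; nra.
Qed.

(** * Integrals over a period *)

Lemma ex_RInt_cont (f : R -> R) (a b : R) :
  (forall x, continuous f x) -> ex_RInt f a b.
Proof. intros H; apply (ex_RInt_continuous (V := R_CompleteNormedModule)); intros; apply H. Qed.

Lemma ex_RInt_smooth (f : R -> R) (a b : R) : smooth f -> ex_RInt f a b.
Proof. intros H; apply ex_RInt_cont; intros; apply smooth_continuous, H. Qed.

Lemma continuous_Rmult (f g : R -> R) (x : R) :
  continuous f x -> continuous g x -> continuous (fun y => f y * g y) x.
Proof. intros Hf Hg; exact (continuous_mult f g x Hf Hg). Qed.

Lemma RInt_Rscal (f : R -> R) (c a b : R) :
  (forall x, continuous f x) -> RInt (fun x => c * f x) a b = c * RInt f a b.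
Proof. intros H; exact (RInt_scal f a b c (ex_RInt_cont f a b H)). Qed.

Lemma RInt_Rplus (f g : R -> R) (a b : R) :
  (forall x, continuous f x) -> (forall x, continuous g x) ->
  RInt (fun x => f x + g x) a b = RInt f a b + RInt g a b.
Proof.
  intros Hf Hg.
  exact (RInt_plus f g a b (ex_RInt_cont f a b Hf) (ex_RInt_cont g a b Hg)).
Qed.

Lemma RInt_Rconst (c a b : R) : RInt (fun _ => c) a b = (b - a) * c.
Proof. exact (RInt_const a b c). Qed.

Lemma Cauchy_Schwarz (f g : R -> R) (a b : R) :
  a <= b -> (forall x, continuous f x) -> (forall x, continuous g x) ->
  (RInt (fun x => f x * g x) a b) ^ 2
  <= RInt (fun x => f x * f x) a b * RInt (fun x => g x * g x) a b.
Proof.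
  intros Hab Hf Hg.
  set (F := RInt (fun x => f x * f x) a b).
  set (G := RInt (fun x => g x * g x) a b).
  set (H := RInt (fun x => f x * g x) a b).
  assert (Cff : forall x, continuous (fun x => f x * f x) x)
    by (intros; apply continuous_Rmult; auto).
  assert (Cgg : forall x, continuous (fun x => g x * g x) x)
    by (intros; apply continuous_Rmult; auto).
  assert (Cfg : forall x, continuous (fun x => f x * g x) x)
    by (intros; apply continuous_Rmult; auto).
  assert (Cs : forall c h, (forall x, continuous h x) ->
    forall x : R, continuous (fun x => c * h x) x).
  { intros c h Hh x; apply continuous_Rmult; [apply continuous_const|apply Hh]. }
  assert (Q : forall s t, 0 <= s * s * F + (2 * s * t * H + t * t * G)).
  { intros s t; unfold F, G, H.
    rewrite <- !RInt_Rscal by assumption.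
    rewrite <- RInt_Rplus by (apply Cs; assumption).
    rewrite <- RInt_Rplus.
    - apply RInt_ge_0; [exact Hab| |].
      + apply ex_RInt_cont; intros x.
        apply (continuous_plus (V := R_NormedModule));
          [|apply (continuous_plus (V := R_NormedModule))]; apply Cs; assumption.
      + intros x _.
        replace (s * s * (f x * f x) + (2 * s * t * (f x * g x) + t * t * (g x * g x)))
          with ((s * f x + t * g x) ^ 2) by ring.
        apply pow2_ge_0.
    - apply Cs; assumption.
    - intros x; apply (continuous_plus (V := R_NormedModule)); apply Cs; assumption. }
  (* The choice (H, -F) gives F (F G - H^2) >= 0. If F = 0, the choice (G + 1, -H) gives - H^2 (G +
     2) >= 0, which forces H = 0. *)
  assert (Q1 := Q H (- F)); assert (Q2 := Q 1 0); assert (Q3 := Q 0 1).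
  assert (Q4 := Q (G + 1) (- H)).
  destruct (Req_dec F 0) as [E|E].
  - rewrite E in *; nra.
  - assert (0 < F) by lra.
    assert (0 <= F * (F * G - H * H)) by nra.
    assert (0 <= F * G - H * H).
    { apply Rmult_le_reg_l with F; [assumption|lra]. }
    lra.
Qed.

Lemma periodic_shift (L : R) (f : R -> R) (n : nat) (x : R) :
  torus_periodic L f -> f (x + INR n * L) = f x.
Proof.
  intros Hf; induction n as [|n IH].
  - simpl; f_equal; ring.
  - rewrite S_INR, <- IH, <- (Hf (x + INR n * L)); f_equal; ring.
Qed.

Lemma periodic_representative (L : R) (f : R -> R) (x : R) :
  0 < L -> torus_periodic L f -> exists y, 0 <= y <= L /\ f y = f x.
Proof.
  intros HL Hf.
  destruct (archimed (x / L)) as [A1 A2].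
  set (z := (up (x / L) - 1)%Z).
  exists (x - IZR z * L).
  assert (Ez : IZR z = IZR (up (x / L)) - 1) by (unfold z; rewrite minus_IZR; reflexivity).
  assert (Ex : x = x / L * L) by (field; lra).
  split; [rewrite Ez; nra|].
  destruct (Z.le_ge_cases 0 z) as [Hz|Hz].
  - rewrite <- (periodic_shift L f (Z.to_nat z) (x - IZR z * L) Hf).
    rewrite INR_IZR_INZ, Z2Nat.id by exact Hz; f_equal; ring.
  - rewrite <- (periodic_shift L f (Z.to_nat (- z)) x Hf).
    rewrite INR_IZR_INZ, Z2Nat.id by lia; rewrite opp_IZR; f_equal; ring.
Qed.

Lemma periodic_Derive_n (L : R) (f : R -> R) (k : nat) :
  torus_periodic L f -> torus_periodic L (Derive_n f k).
Proof.
  intros Hf x; rewrite <- Derive_n_comp_trans; apply Derive_n_ext, Hf.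
Qed.

Lemma RInt_Derive_periodic (L : R) (f : R -> R) :
  smooth f -> torus_periodic L f -> RInt (Derive f) 0 L = 0.
Proof.
  intros Sf Pf; rewrite RInt_Derive.
  - assert (H := Pf 0); rewrite Rplus_0_l in H; lra.
  - intros; apply smooth_ex_derive, Sf.
  - intros; apply smooth_continuous, smooth_Derive, Sf.
Qed.

Lemma integration_by_parts_periodic (L : R) (f g : R -> R) :
  smooth f -> smooth g -> torus_periodic L f -> torus_periodic L g ->
  RInt (fun x => f x * Derive g x) 0 L = - RInt (fun x => Derive f x * g x) 0 L.
Proof.
  intros Sf Sg Pf Pg.
  assert (H : RInt (Derive (fun x => f x * g x)) 0 L = 0).
  { apply RInt_Derive_periodic; [smooth_tac|].
    intros x; rewrite Pf, Pg; reflexivity. }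
  rewrite Derive_mult_smooth, RInt_Rplus in H by
    (try assumption; intros; apply smooth_continuous; smooth_tac).
  lra.
Qed.

(** * Sobolev and Poincare inequalities on the circle *)

Definition l2sq (L : R) (f : R -> R) : R := RInt (fun x => f x ^ 2) 0 L.

Lemma l2sq_nonneg (L : R) (f : R -> R) :
  0 < L -> (forall x, continuous f x) -> 0 <= l2sq L f.
Proof.
  intros HL Hf; apply RInt_ge_0; [lra| |intros; apply pow2_ge_0].
  apply ex_RInt_cont; intros x; apply continuous_Rmult; [apply Hf|].
  apply continuous_Rmult; [apply Hf|apply continuous_const].
Qed.

Lemma l2sq_le_sup (L M : R) (f : R -> R) :
  0 < L -> (forall x, continuous f x) -> (forall x, f x ^ 2 <= M) -> l2sq L f <= L * M.
Proof.
  intros HL Hf HM; apply Rle_trans with ((L - 0) * M); [|right; ring].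
  rewrite <- RInt_Rconst.
  apply RInt_le; [lra| |apply ex_RInt_const|intros; apply HM].
  apply ex_RInt_cont; intros x; apply continuous_Rmult; [apply Hf|].
  apply continuous_Rmult; [apply Hf|apply continuous_const].
Qed.

Lemma l2sq_square (L : R) (f : R -> R) : l2sq L f = RInt (fun x => f x * f x) 0 L.
Proof. unfold l2sq; f_equal; apply functional_extensionality; intros; ring. Qed.

(** f x - f y is the integral of f' times 1 over [y, x]; Cauchy-Schwarz gives the factor x - y <= L,
    and the integral of f'^2 is then enlarged to the whole period. *)
Lemma oscillation_bound (L : R) (f : R -> R) (x y : R) :
  smooth f -> 0 <= y <= x -> x <= L -> (f x - f y) ^ 2 <= L * l2sq L (Derive f).
Proof.
  intros Sf Hy Hx.
  assert (Cf : forall z, continuous (Derive f) z)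
    by (intros; apply smooth_continuous; smooth_tac).
  assert (Cff : forall z, continuous (fun z => Derive f z * Derive f z) z)
    by (intros; apply smooth_continuous; smooth_tac).
  assert (H := Cauchy_Schwarz (Derive f) (fun _ => 1) y x (proj2 Hy) Cf
                (fun z => continuous_const 1 z)).
  rewrite (RInt_ext _ (Derive f)) in H by (intros; apply Rmult_1_r).
  rewrite RInt_Derive in H by
    (intros; first [apply smooth_ex_derive; assumption | apply Cf]).
  rewrite RInt_Rconst in H.
  eapply Rle_trans; [exact H|].
  rewrite l2sq_square.
  set (h := fun z => Derive f z * Derive f z) in *.
  assert (Pos : forall u v, u <= v -> 0 <= RInt h u v).
  { intros u v Huv; apply RInt_ge_0; [exact Huv|apply ex_RInt_cont, Cff|].
    intros z _; apply Rle_0_sqr. }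
  assert (E1 := RInt_Chasles h 0 y L (ex_RInt_cont _ _ _ Cff) (ex_RInt_cont _ _ _ Cff)).
  assert (E2 := RInt_Chasles h y x L (ex_RInt_cont _ _ _ Cff) (ex_RInt_cont _ _ _ Cff)).
  unfold plus in E1, E2; simpl in E1, E2.
  assert (P1 := Pos 0 y (proj1 Hy)); assert (P2 := Pos y x (proj2 Hy)).
  assert (P3 := Pos x L Hx).
  rewrite <- E1, <- E2; nra.
Qed.

(** Zero mean turns L f(y) into the integral over z of f(y) - f(z), which the oscillation bound
    controls. This one inequality yields both the Sobolev embedding and the Poincare inequality. *)
Lemma sup_le_l2_Derive (L : R) (f : R -> R) (x : R) :
  0 < L -> smooth f -> torus_periodic L f -> RInt f 0 L = 0 ->
  f x ^ 2 <= L * l2sq L (Derive f).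
Proof.
  intros HL Sf Pf H0.
  destruct (periodic_representative L f x HL Pf) as [y [Hy <-]].
  assert (Cf : forall z, continuous f z) by (intros; apply smooth_continuous, Sf).
  assert (HM : 0 <= L * l2sq L (Derive f)).
  { apply Rmult_le_pos; [lra|apply l2sq_nonneg; [exact HL|]].
    intros; apply smooth_continuous; smooth_tac. }
  set (M := L * l2sq L (Derive f)) in *.
  assert (B : Rabs (RInt (fun z => f y + -1 * f z) 0 L) <= (L - 0) * sqrt M).
  { apply abs_RInt_le_const; [lra|apply ex_RInt_smooth; smooth_tac|].
    intros z Hz; 
    rewrite <- sqrt_Rsqr_abs; apply sqrt_le_1_alt; unfold Rsqr.
    destruct (Rle_dec z y) as [h|h].
    - assert (H := oscillation_bound L f y z Sf (conj (proj1 Hz) h) (proj2 Hy)).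
      fold M in H; eapply Rle_trans; [right|exact H]; ring.
    - assert (H := oscillation_bound L f z y Sf (conj (proj1 Hy) (Rlt_le _ _ (Rnot_le_lt _ _ h))) (proj2 Hz)).
      fold M in H; eapply Rle_trans; [right|exact H]; ring. }
  rewrite RInt_Rplus, RInt_Rscal, H0, RInt_Rconst in B
    by (intros; try apply smooth_continuous; smooth_tac).
  replace ((L - 0) * f y + -1 * 0) with (L * f y) in B by ring.
  rewrite Rabs_mult, (Rabs_pos_eq L), Rminus_0_r in B by lra.
  apply Rmult_le_reg_l in B; [|exact HL].
  rewrite <- (pow2_abs (f y)), <- (pow2_sqrt M HM).
  apply pow_incr; split; [apply Rabs_pos|exact B].
Qed.

Lemma RInt_Derive_n_periodic (L : R) (f : R -> R) (k : nat) :
  smooth f -> torus_periodic L f -> RInt f 0 L = 0 -> RInt (Derive_n f k) 0 L = 0.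
Proof.
  intros Sf Pf H0; destruct k as [|k]; [exact H0|].
  apply (RInt_Derive_periodic L (Derive_n f k)); [smooth_tac|].
  apply periodic_Derive_n, Pf.
Qed.

(** Convertible to the radicand of [sobolev_norm], so that [change] passes between the two. *)
Definition sobolev_sq (L : R) (m : nat) (f : R -> R) : R :=
  sum_n (fun k => l2sq L (Derive_n f k)) m.

Lemma sum_n_Rle (a b : nat -> R) (n : nat) :
  (forall k, (k <= n)%nat -> a k <= b k) -> sum_n a n <= sum_n b n.
Proof.
  intros H; induction n as [|n IH].
  - rewrite !sum_O; apply H; lia.
  - rewrite !sum_Sn; apply Rplus_le_compat; [apply IH; intros; apply H; lia|apply H; lia].
Qed.

Lemma sum_n_term_le (a : nat -> R) (n k : nat) :
  (forall j, 0 <= a j) -> (k <= n)%nat -> a k <= sum_n a n.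
Proof.
  intros Ha Hk; induction n as [|n IH].
  - replace k with 0%nat by lia; rewrite sum_O; lra.
  - rewrite sum_Sn; unfold plus; simpl.
    assert (P := Ha (S n)).
    assert (P' : 0 <= sum_n a n).
    { clear -Ha; induction n as [|n IH]; [rewrite sum_O; apply Ha|].
      rewrite sum_Sn; apply Rplus_le_le_0_compat; [exact IH|apply Ha]. }
    destruct (Nat.eq_dec k (S n)) as [->|Hne]; [lra|].
    assert (a k <= sum_n a n) by (apply IH; lia); lra.
Qed.

Lemma sum_n_Rconst (c : R) (n : nat) : sum_n (fun _ => c) n = INR (S n) * c.
Proof. apply sum_n_const. Qed.

Lemma l2sq_Derive_n_nonneg (L : R) (f : R -> R) (k : nat) :
  0 < L -> smooth f -> 0 <= l2sq L (Derive_n f k).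
Proof.
  intros HL Sf; apply l2sq_nonneg; [exact HL|].
  intros; apply smooth_continuous; smooth_tac.
Qed.

Lemma l2sq_Derive_n_le (L : R) (m k : nat) (f : R -> R) :
  0 < L -> smooth f -> (k <= m)%nat -> l2sq L (Derive_n f k) <= sobolev_sq L m f.
Proof.
  intros HL Sf Hk; apply (sum_n_term_le (fun k => l2sq L (Derive_n f k))); [|exact Hk].
  intros; apply l2sq_Derive_n_nonneg; assumption.
Qed.

Lemma sobolev_sq_nonneg (L : R) (m : nat) (f : R -> R) :
  0 < L -> smooth f -> 0 <= sobolev_sq L m f.
Proof.
  intros HL Sf; eapply Rle_trans;
    [apply (l2sq_Derive_n_nonneg L f 0 HL Sf)|apply l2sq_Derive_n_le; try assumption; lia].
Qed.

Lemma Derive_n_sup_bound (L : R) (f : R -> R) (k : nat) (x : R) :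
  0 < L -> smooth f -> torus_periodic L f -> RInt f 0 L = 0 ->
  Derive_n f k x ^ 2 <= L * l2sq L (Derive_n f (S k)).
Proof.
  intros HL Sf Pf H0; apply (sup_le_l2_Derive L (Derive_n f k)).
  - exact HL.
  - smooth_tac.
  - apply periodic_Derive_n, Pf.
  - apply RInt_Derive_n_periodic; assumption.
Qed.

(** Each order is bounded in sup norm by the L^2 norm of the next one, with a factor L in the
    squares; integrating over a period costs a second factor L. *)
Lemma poincare (L : R) (m : nat) (f : R -> R) :
  0 < L -> smooth f -> torus_periodic L f -> RInt f 0 L = 0 ->
  sobolev_sq L m f <= L ^ 2 * sobolev_sq L m (Derive f).
Proof.
  intros HL Sf Pf H0; unfold sobolev_sq.
  rewrite <- (sum_n_mult_l (K := R_Ring) (L ^ 2)).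
  apply sum_n_Rle; intros k Hk; unfold mult; simpl.
  rewrite <- Derive_n_succ.
  replace (L * (L * 1) * l2sq L (Derive_n f (S k)))
    with (L * (L * l2sq L (Derive_n f (S k)))) by ring.
  apply l2sq_le_sup; [exact HL|intros; apply smooth_continuous; smooth_tac|].
  intros x; apply Derive_n_sup_bound; assumption.
Qed.

(** The hypothesis concerns [Derive f] because order j in sup norm costs order j + 1 in L^2. It
    serves at order p with Y and at order p + 1 with Z. *)
Lemma dbound_sobolev (L M : R) (m : nat) (f : R -> R) :
  0 < L -> smooth f -> torus_periodic L f -> RInt f 0 L = 0 ->
  sobolev_sq L m (Derive f) <= M -> dbound m (sqrt (L * M)) f.
Proof.
  intros HL Sf Pf H0 HM j x Hj.
  rewrite <- sqrt_Rsqr_abs; apply sqrt_le_1_alt; rewrite Rsqr_pow2.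
  eapply Rle_trans; [apply Derive_n_sup_bound; eassumption|].
  apply Rmult_le_compat_l; [lra|]; eapply Rle_trans; [|exact HM].
  rewrite Derive_n_succ; apply l2sq_Derive_n_le; [exact HL|smooth_tac|exact Hj].
Qed.

Lemma sobolev_sq_Derive_le (L : R) (m : nat) (f : R -> R) :
  0 < L -> smooth f -> sobolev_sq L m (Derive f) <= sobolev_sq L (S m) f.
Proof.
  intros HL Sf; induction m as [|m IH]; unfold sobolev_sq in *.
  - rewrite sum_Sn, !sum_O; unfold plus; simpl.
    assert (H := l2sq_Derive_n_nonneg L f 0 HL Sf); change (0 <= l2sq L f) in H.
    change (l2sq L (Derive f) <= l2sq L f + l2sq L (Derive f)); lra.
  - rewrite (sum_Sn _ (S m)), sum_Sn; apply Rplus_le_compat; [exact IH|].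
    apply Req_le; rewrite (Derive_n_succ f (S m)); reflexivity.
Qed.

(** * The energy inequality at a fixed time *)

Lemma flux_bound (p : nat) (rhobar fbar gbar : R) F G :
  (1 <= p)%nat -> admissible p rhobar fbar F -> admissible p rhobar gbar G ->
  exists C, 0 <= C /\ forall N D r b, near p rhobar N D r b ->
    smooth (fun x => F r b x * Derive r x + G r b x * Derive b x) /\
    forall k x, (k <= S p)%nat ->
    Rabs (Derive_n (fun x => F r b x * Derive r x + G r b x * Derive b x) k x
          - (fbar * Derive_n r (S k) x + gbar * Derive_n b (S k) x))
      <= C * N * (2 * D + Rabs (Derive_n r (S k) x) + Rabs (Derive_n b (S k) x)).
Proof.
  intros Hp HF HG.
  destruct (flux_term_bound p rhobar fbar F Hp HF) as (C1 & HC1 & H1).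
  destruct (flux_term_bound p rhobar gbar G Hp HG) as (C2 & HC2 & H2).
  destruct HF as (K1 & _ & HF); destruct HG as (K2 & _ & HG).
  exists (C1 + C2); split; [lra|]; intros N D r b Hn.
  destruct (HF N D r b Hn) as (SF & _); destruct (HG N D r b Hn) as (SG & _).
  assert (Hn' := Hn).
  destruct Hn' as (HN & HN' & HD & Sr & Sb & R1 & R2 & B1 & B2).
  split; [smooth_tac|].
  intros k x Hk; rewrite Derive_n_plus_smooth by smooth_tac.
  specialize (H1 N D r b Hn r Sr R1 R2 k x Hk).
  specialize (H2 N D r b Hn b Sb B1 B2 k x Hk).
  set (X := Derive_n r (S k) x) in *; set (W := Derive_n b (S k) x) in *.
  set (P := Derive_n (fun x => F r b x * Derive r x) k x) in *.
  set (Q := Derive_n (fun x => G r b x * Derive b x) k x) in *.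
  replace (P + Q - (fbar * X + gbar * W)) with ((P - fbar * X) + (Q - gbar * W)) by ring.
  eapply Rle_trans; [apply Rabs_triang|].
  assert (PX := Rabs_pos X); assert (PW := Rabs_pos W).
  apply Rle_trans with (C1 * N * (2 * D + Rabs X + Rabs W)
                        + C2 * N * (2 * D + Rabs X + Rabs W)); [|right; ring].
  apply Rplus_le_compat; (eapply Rle_trans; [eassumption|]);
    apply Rmult_le_compat_l; try lra; apply Rmult_le_pos; lra.
Qed.

Definition flux_rho (gamma rhobar Bbar : R) (r b : R -> R) (x : R) : R :=
  Rpower (rhobar + r x) (gamma - 1) * Derive r x + (Bbar + b x) * Derive b x.

(** The flux of the B equation with the pressure gradient expanded and the powers of the density
    merged; 1 / rho is a power of exponent -1 so that every coefficient is a sum of products of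
    admissible pieces. *)
Definition flux_B (gamma B0 rhobar Bbar : R) (r b : R -> R) (x : R) : R :=
  (Bbar + b x) * Rpower (rhobar + r x) (gamma - 2) * Derive r x
  + ((Bbar + b x) * (Bbar + b x) + B0 ^ 2) * Rpower (rhobar + r x) (-1) * Derive b x.

Lemma flux_rho_periodic (L gamma rhobar Bbar : R) (r b : R -> R) :
  torus_periodic L r -> torus_periodic L b ->
  torus_periodic L (flux_rho gamma rhobar Bbar r b).
Proof.
  intros Pr Pb x; unfold flux_rho.
  assert (E1 : Derive r (x + L) = Derive r x) by exact (periodic_Derive_n L r 1 Pr x).
  assert (E2 : Derive b (x + L) = Derive b x) by exact (periodic_Derive_n L b 1 Pb x).
  rewrite E1, E2, Pr, Pb; reflexivity.
Qed.

Lemma flux_B_periodic (L gamma B0 rhobar Bbar : R) (r b : R -> R) :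
  torus_periodic L r -> torus_periodic L b ->
  torus_periodic L (flux_B gamma B0 rhobar Bbar r b).
Proof.
  intros Pr Pb x; unfold flux_B.
  assert (E1 : Derive r (x + L) = Derive r x) by exact (periodic_Derive_n L r 1 Pr x).
  assert (E2 : Derive b (x + L) = Derive b x) by exact (periodic_Derive_n L b 1 Pb x).
  rewrite E1, E2, Pr, Pb; reflexivity.
Qed.

Lemma flux_rho_bound (p : nat) (gamma rhobar Bbar : R) :
  (1 <= p)%nat -> 0 < rhobar ->
  exists C, 0 <= C /\ forall N D r b, near p rhobar N D r b ->
    smooth (flux_rho gamma rhobar Bbar r b) /\
    forall k x, (k <= S p)%nat ->
    Rabs (Derive_n (flux_rho gamma rhobar Bbar r b) k x
          - (Rpower rhobar (gamma - 1) * Derive_n r (S k) x + Bbar * Derive_n b (S k) x))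
      <= C * N * (2 * D + Rabs (Derive_n r (S k) x) + Rabs (Derive_n b (S k) x)).
Proof.
  intros Hp H0.
  exact (flux_bound p rhobar _ _ _ _ Hp (admissible_Rpower p rhobar (gamma - 1) H0)
           (admissible_B p rhobar Bbar)).
Qed.

Lemma flux_B_bound (p : nat) (gamma B0 rhobar Bbar : R) :
  (1 <= p)%nat -> 0 < rhobar ->
  exists C, 0 <= C /\ forall N D r b, near p rhobar N D r b ->
    smooth (flux_B gamma B0 rhobar Bbar r b) /\
    forall k x, (k <= S p)%nat ->
    Rabs (Derive_n (flux_B gamma B0 rhobar Bbar r b) k x
          - (Bbar * Rpower rhobar (gamma - 2) * Derive_n r (S k) x
             + (Bbar * Bbar + B0 ^ 2) * Rpower rhobar (-1) * Derive_n b (S k) x))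
      <= C * N * (2 * D + Rabs (Derive_n r (S k) x) + Rabs (Derive_n b (S k) x)).
Proof.
  intros Hp H0.
  assert (HB := admissible_B p rhobar Bbar).
  exact (flux_bound p rhobar _ _ _ _ Hp
    (admissible_mult _ _ _ _ _ _ HB (admissible_Rpower p rhobar (gamma - 2) H0))
    (admissible_mult _ _ _ _ _ _
      (admissible_plus _ _ _ _ _ _ (admissible_mult _ _ _ _ _ _ HB HB)
        (admissible_const p rhobar (B0 ^ 2)))
      (admissible_Rpower p rhobar (-1) H0))).
Qed.

(** With M the symmetric matrix of the form, Cayley-Hamilton gives tr(M) <Mv, v> = det(M) |v|^2 +
    |Mv|^2; hence the constant det(M) / tr(M). *)
Lemma quadratic_form_coercive (a b d : R) :
  0 < a -> 0 < d -> 0 < a * d - b * b ->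
  exists c, 0 < c /\ forall X W,
    c * (X ^ 2 + W ^ 2) <= a * X ^ 2 + 2 * b * X * W + d * W ^ 2.
Proof.
  intros Ha Hd Hdet; exists ((a * d - b * b) / (a + d)).
  split; [apply Rdiv_lt_0_compat; lra|]; intros X W.
  apply Rmult_le_reg_l with (a + d); [lra|].
  replace ((a + d) * ((a * d - b * b) / (a + d) * (X ^ 2 + W ^ 2)))
    with ((a * d - b * b) * (X ^ 2 + W ^ 2)) by (field; lra).
  assert (H1 := pow2_ge_0 (a * X + b * W)); assert (H2 := pow2_ge_0 (b * X + d * W)).
  replace ((a + d) * (a * X ^ 2 + 2 * b * X * W + d * W ^ 2))
    with ((a * d - b * b) * (X ^ 2 + W ^ 2) + ((a * X + b * W) ^ 2 + (b * X + d * W) ^ 2))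
    by ring.
  lra.
Qed.

(* At the equilibrium [diag (alpha, 1)] with [alpha = rhobar ^ (gamma - 2)], the
   Hessian of the entropy, symmetrizes the diffusion matrix. *)
Lemma symmetrized_diffusion_coercive (gamma B0 rhobar Bbar : R) :
  B0 <> 0 -> 0 < rhobar ->
  exists c, 0 < c /\ forall X W,
    c * (X ^ 2 + W ^ 2) <=
    Rpower rhobar (gamma - 2) * X * (Rpower rhobar (gamma - 1) * X + Bbar * W)
    + W * (Bbar * Rpower rhobar (gamma - 2) * X
           + (Bbar * Bbar + B0 ^ 2) * Rpower rhobar (-1) * W).
Proof.
  intros HB H0.
  assert (HA : 0 < Rpower rhobar (gamma - 2)) by apply exp_pos.
  assert (E1 : Rpower rhobar (gamma - 1) = Rpower rhobar (gamma - 2) * rhobar).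
  { rewrite <- (Rpower_1 rhobar H0) at 3; rewrite <- Rpower_plus; f_equal; ring. }
  assert (E2 : Rpower rhobar (-1) = / rhobar).
  { replace (-1) with (- (1)) by ring; rewrite Rpower_Ropp, Rpower_1 by exact H0; reflexivity. }
  rewrite E1, E2; set (A := Rpower rhobar (gamma - 2)) in *.
  assert (HB2 : 0 < B0 * B0) by nra.
  destruct (quadratic_form_coercive (A * (A * rhobar)) (A * Bbar)
              ((Bbar * Bbar + B0 ^ 2) * / rhobar)) as (c & Hc & H).
  - apply Rmult_lt_0_compat; [exact HA|apply Rmult_lt_0_compat; assumption].
  - apply Rmult_lt_0_compat; [simpl; nra|apply Rinv_0_lt_compat, H0].
  - replace (A * (A * rhobar) * ((Bbar * Bbar + B0 ^ 2) * / rhobar) - A * Bbar * (A * Bbar))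
      with (A * A * (B0 * B0)) by (field; lra).
    apply Rmult_lt_0_compat; [apply Rmult_lt_0_compat|]; assumption.
  - exists c; split; [exact Hc|]; intros X W; eapply Rle_trans; [apply H|right; ring].
Qed.

(** In the application [P0] and [Q0] come from the constant-coefficient fluxes and [e] is a multiple
    of N. The 4 is Young's inequality: (u + v) (2 D + u + v) <= D^2 + 2 (u + v)^2 <= 4 (D^2 + u^2 +
    v^2). *)
Lemma perturbed_dissipation (alpha c e D X W P Q P0 Q0 : R) :
  0 <= alpha -> 0 <= e -> 0 <= D ->
  c * (X ^ 2 + W ^ 2) <= alpha * X * P0 + W * Q0 ->
  Rabs (P - P0) <= e * (2 * D + Rabs X + Rabs W) ->
  Rabs (Q - Q0) <= e * (2 * D + Rabs X + Rabs W) ->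
  - (alpha * (X * P) + W * Q)
  <= - c * (X ^ 2 + W ^ 2) + 4 * (alpha + 1) * e * (D ^ 2 + (X ^ 2 + W ^ 2)).
Proof.
  intros Ha He HD Hq HP HQ.
  assert (PX := Rabs_pos X); assert (PW := Rabs_pos W).
  assert (EX := pow2_abs X); assert (EW := pow2_abs W).
  set (T := e * (2 * D + Rabs X + Rabs W)) in *.
  assert (B1 : - (X * (P - P0)) <= Rabs X * T).
  { eapply Rle_trans; [apply Rle_abs|]; rewrite Rabs_Ropp, Rabs_mult.
    apply Rmult_le_compat_l; assumption. }
  assert (B2 : - (W * (Q - Q0)) <= Rabs W * T).
  { eapply Rle_trans; [apply Rle_abs|]; rewrite Rabs_Ropp, Rabs_mult.
    apply Rmult_le_compat_l; assumption. }
  assert (B3 : alpha * - (X * (P - P0)) <= alpha * (Rabs X * T))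
    by (apply Rmult_le_compat_l; assumption).
  set (u := Rabs X) in *; set (v := Rabs W) in *.
  assert (HT : 0 <= T) by (unfold T; apply Rmult_le_pos; lra).
  assert (B4 : alpha * (u * T) + v * T <= (alpha + 1) * ((u + v) * T)).
  { assert (0 <= u * T) by (apply Rmult_le_pos; assumption).
    assert (0 <= v * T) by (apply Rmult_le_pos; assumption).
    assert (0 <= alpha * (v * T)) by (apply Rmult_le_pos; assumption). nra. }
  assert (B5 : (u + v) * (2 * D + u + v) <= 4 * (D ^ 2 + (X ^ 2 + W ^ 2))).
  { rewrite <- EX, <- EW.
    assert (S1 := pow2_ge_0 (u + v - D)); assert (S2 := pow2_ge_0 (u - v)).
    assert (S3 := pow2_ge_0 D). nra. }
  assert (B6 : (alpha + 1) * ((u + v) * T) <= (alpha + 1) * e * (4 * (D ^ 2 + (X ^ 2 + W ^ 2)))).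
  { unfold T.
    replace ((alpha + 1) * ((u + v) * (e * (2 * D + u + v))))
      with ((alpha + 1) * e * ((u + v) * (2 * D + u + v))) by ring.
    apply Rmult_le_compat_l; [apply Rmult_le_pos; lra|exact B5]. }
  nra.
Qed.

Lemma dissipation_order_k (p : nat) (L gamma B0 rhobar Bbar : R) :
  0 < L -> (1 <= p)%nat -> B0 <> 0 -> 0 < rhobar ->
  exists c C, 0 < c /\ 0 <= C /\ forall N D r b, near p rhobar N D r b ->
    torus_periodic L r -> torus_periodic L b ->
    forall k, (k <= S p)%nat ->
    Rpower rhobar (gamma - 2) *
      RInt (fun x => Derive_n r k x * Derive_n (flux_rho gamma rhobar Bbar r b) (S k) x) 0 L
    + RInt (fun x => Derive_n b k x * Derive_n (flux_B gamma B0 rhobar Bbar r b) (S k) x) 0 L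
    <= - c * (l2sq L (Derive_n r (S k)) + l2sq L (Derive_n b (S k)))
       + C * N * (L * D ^ 2 + (l2sq L (Derive_n r (S k)) + l2sq L (Derive_n b (S k)))).
Proof.
  intros HL Hp HB H0.
  destruct (flux_rho_bound p gamma rhobar Bbar Hp H0) as (C1 & HC1 & H1).
  destruct (flux_B_bound p gamma B0 rhobar Bbar Hp H0) as (C2 & HC2 & H2).
  destruct (symmetrized_diffusion_coercive gamma B0 rhobar Bbar HB H0) as (c & Hc & Hq).
  set (alpha := Rpower rhobar (gamma - 2)) in *.
  assert (Ha : 0 < alpha) by apply exp_pos.
  exists c, (4 * (alpha + 1) * (C1 + C2)); split; [exact Hc|split].
  { apply Rmult_le_pos; lra. }
  intros N D r b Hn Pr Pb k Hk.
  destruct (H1 N D r b Hn) as [SP BP]; destruct (H2 N D r b Hn) as [SQ BQ].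
  destruct Hn as (HN & HN' & HD & Sr & Sb & _).
  set (P := flux_rho gamma rhobar Bbar r b) in *.
  set (Q := flux_B gamma B0 rhobar Bbar r b) in *.
  assert (PP : torus_periodic L P) by (apply flux_rho_periodic; assumption).
  assert (PQ : torus_periodic L Q) by (apply flux_B_periodic; assumption).
  (* Moving one derivative off the flux leaves order k of the fluxes against order k + 1 of r and b,
     which is the setting of the pointwise estimate integrated below. *)
  assert (I1 := integration_by_parts_periodic L (Derive_n r k) (Derive_n P k)
    (smooth_Derive_n _ k Sr) (smooth_Derive_n _ k SP)
    (periodic_Derive_n L r k Pr) (periodic_Derive_n L P k PP)).
  assert (I2 := integration_by_parts_periodic L (Derive_n b k) (Derive_n Q k)
    (smooth_Derive_n _ k Sb) (smooth_Derive_n _ k SQ)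
    (periodic_Derive_n L b k Pb) (periodic_Derive_n L Q k PQ)).
  change (Derive (Derive_n P k)) with (Derive_n P (S k)) in I1.
  change (Derive (Derive_n Q k)) with (Derive_n Q (S k)) in I2.
  change (Derive (Derive_n r k)) with (Derive_n r (S k)) in I1.
  change (Derive (Derive_n b k)) with (Derive_n b (S k)) in I2.
  rewrite I1, I2, !l2sq_square.
  set (X := Derive_n r (S k)); set (W := Derive_n b (S k)).
  assert (SX : smooth X) by (unfold X; smooth_tac).
  assert (SW : smooth W) by (unfold W; smooth_tac).
  set (e := (C1 + C2) * N).
  assert (He : 0 <= e) by (apply Rmult_le_pos; lra).
  assert (SPk := smooth_Derive_n P k SP); assert (SQk := smooth_Derive_n Q k SQ).
  set (Pk := Derive_n P k) in *; set (Qk := Derive_n Q k) in *.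
  assert (M : RInt (fun x => - alpha * (X x * Pk x) + -1 * (W x * Qk x)) 0 L
    <= RInt (fun x => (- c + 4 * (alpha + 1) * e) * (X x * X x + W x * W x)
                      + 4 * (alpha + 1) * e * D ^ 2) 0 L).
  { apply RInt_le; [lra|apply ex_RInt_smooth; smooth_tac|apply ex_RInt_smooth; smooth_tac|].
    intros x _.
    assert (T : forall C, 0 <= C -> C <= C1 + C2 -> C * N * (2 * D + Rabs (X x) + Rabs (W x))
      <= e * (2 * D + Rabs (X x) + Rabs (W x))).
    { intros C HC HC'; assert (PX := Rabs_pos (X x)); assert (PW := Rabs_pos (W x)).
      apply Rmult_le_compat_r; [lra|]; unfold e; apply Rmult_le_compat_r; lra. }
    assert (K := perturbed_dissipation alpha c e D (X x) (W x) (Pk x) (Qk x) _ _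
      (Rlt_le _ _ Ha) He HD (Hq (X x) (W x))
      (Rle_trans _ _ _ (BP k x Hk) (T C1 HC1 ltac:(lra)))
      (Rle_trans _ _ _ (BQ k x Hk) (T C2 HC2 ltac:(lra)))).
    nra. }
  rewrite !RInt_Rplus, !RInt_Rscal, RInt_Rplus, RInt_Rconst in M
    by (intros; apply smooth_continuous; smooth_tac).
  fold X W Pk Qk in M |- *.
  unfold e in M; nra.
Qed.

Lemma sum_n_affine (u : nat -> R) (a b : R) (n : nat) :
  sum_n (fun k => a * u k + b) n = a * sum_n u n + INR (S n) * b.
Proof.
  induction n as [|n IH]; [rewrite !sum_O; simpl; ring|].
  rewrite !sum_Sn, IH, (S_INR (S n)); unfold plus; simpl; ring.
Qed.

Lemma sum_n_Rplus (u v : nat -> R) (n : nat) :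
  sum_n (fun k => u k + v k) n = sum_n u n + sum_n v n.
Proof. exact (sum_n_plus u v n). Qed.

Lemma sum_n_Rscal (a : R) (u : nat -> R) (n : nat) :
  sum_n (fun k => a * u k) n = a * sum_n u n.
Proof. exact (sum_n_mult_l (K := R_Ring) a u n). Qed.

Definition energy (L alpha : R) (m : nat) (r b : R -> R) : R :=
  alpha * sobolev_sq L m r + sobolev_sq L m b.

(** Half the time derivative of the order-k part of the energy, with r_t and b_t replaced by the
    space derivatives of the fluxes. *)
Definition energy_flux (L gamma B0 rhobar Bbar : R) (r b : R -> R) (k : nat) : R :=
  Rpower rhobar (gamma - 2) *
    RInt (fun x => Derive_n r k x * Derive_n (flux_rho gamma rhobar Bbar r b) (S k) x) 0 L
  + RInt (fun x => Derive_n b k x * Derive_n (flux_B gamma B0 rhobar Bbar r b) (S k) x) 0 L.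

Lemma near_of_sobolev_sq (p : nat) (L rhobar Y Z : R) (r b : R -> R) :
  0 < L -> smooth r -> smooth b -> torus_periodic L r -> torus_periodic L b ->
  RInt r 0 L = 0 -> RInt b 0 L = 0 ->
  sobolev_sq L (S p) r + sobolev_sq L (S p) b <= Y ->
  sobolev_sq L (S p) (Derive r) + sobolev_sq L (S p) (Derive b) <= Z ->
  sqrt (L * Y) <= 1 -> sqrt (L * Y) <= rhobar / 2 ->
  near p rhobar (sqrt (L * Y)) (sqrt (L * Z)) r b.
Proof.
  intros HL Sr Sb Pr Pb Mr Mb HY HZ H1 H2.
  assert (A1 := sobolev_sq_Derive_le L p r HL Sr).
  assert (A2 := sobolev_sq_Derive_le L p b HL Sb).
  assert (A3 := sobolev_sq_nonneg L (S p) r HL Sr).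
  assert (A4 := sobolev_sq_nonneg L (S p) b HL Sb).
  assert (A5 := sobolev_sq_nonneg L (S p) (Derive r) HL (smooth_Derive _ Sr)).
  assert (A6 := sobolev_sq_nonneg L (S p) (Derive b) HL (smooth_Derive _ Sb)).
  split; [split; [apply sqrt_pos|exact H1]|].
  split; [exact H2|split; [apply sqrt_pos|]].
  split; [exact Sr|split; [exact Sb|]].
  split; [|split; [|split]]; apply dbound_sobolev; try assumption; lra.
Qed.

Lemma energy_flux_sum_bound (p : nat) (L gamma B0 rhobar Bbar : R) :
  0 < L -> (1 <= p)%nat -> B0 <> 0 -> 0 < rhobar ->
  exists eta c, 0 < eta /\ 0 < c /\ forall Y r b, smooth r -> smooth b ->
    torus_periodic L r -> torus_periodic L b -> RInt r 0 L = 0 -> RInt b 0 L = 0 ->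
    sobolev_sq L (S p) r + sobolev_sq L (S p) b <= Y -> sqrt (L * Y) <= eta ->
    (exists D, near p rhobar (sqrt (L * Y)) D r b) /\
    sum_n (energy_flux L gamma B0 rhobar Bbar r b) (S p)
      <= - c * (sobolev_sq L (S p) (Derive r) + sobolev_sq L (S p) (Derive b)).
Proof.
  intros HL Hp HB H0.
  destruct (dissipation_order_k p L gamma B0 rhobar Bbar HL Hp HB H0)
    as (c & C & Hc & HC & H).
  (* Summing the errors C N (L D^2 + u k) over the orders 0 to S p, with D^2 = L Z, gives exactly K
     N Z. *)
  set (K := C * (INR (S (S p)) * L ^ 2 + 1)).
  assert (HI : 0 <= INR (S (S p))) by apply pos_INR.
  assert (HL2 : 0 < L ^ 2) by (apply pow_lt, HL).
  assert (HK : 0 <= K).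
  { apply Rmult_le_pos; [exact HC|].
    assert (0 <= INR (S (S p)) * L ^ 2) by (apply Rmult_le_pos; lra); lra. }
  (* The first two bounds are the smallness demanded by [near]; the third makes K N <= c / 2, so
     half of the dissipation survives. K + 1 keeps the quotient meaningful when K = 0. *)
  exists (Rmin (Rmin 1 (rhobar / 2)) (c / (2 * (K + 1)))), (c / 2).
  split.
  { apply Rmin_glb_lt; [apply Rmin_glb_lt; lra|apply Rdiv_lt_0_compat; lra]. }
  split; [lra|].
  intros Y r b Sr Sb Pr Pb Mr Mb HY Heta.
  set (Z := sobolev_sq L (S p) (Derive r) + sobolev_sq L (S p) (Derive b)).
  assert (Hn : near p rhobar (sqrt (L * Y)) (sqrt (L * Z)) r b).
  { apply near_of_sobolev_sq; try assumption; [apply Rle_refl| |].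
    - eapply Rle_trans; [exact Heta|].
      eapply Rle_trans; [apply Rmin_l|apply Rmin_l].
    - eapply Rle_trans; [exact Heta|].
      eapply Rle_trans; [apply Rmin_l|apply Rmin_r]. }
  split; [exists (sqrt (L * Z)); exact Hn|].
  assert (HN : 0 <= sqrt (L * Y) <= c / (2 * (K + 1))).
  { split; [apply sqrt_pos|]; eapply Rle_trans; [exact Heta|apply Rmin_r]. }
  set (N := sqrt (L * Y)) in *.
  assert (HZ : 0 <= Z).
  { apply Rplus_le_le_0_compat; apply sobolev_sq_nonneg; try assumption; smooth_tac. }
  assert (HD : sqrt (L * Z) ^ 2 = L * Z).
  { apply pow2_sqrt, Rmult_le_pos; lra. }
  set (u := fun k => l2sq L (Derive_n r (S k)) + l2sq L (Derive_n b (S k))).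
  assert (Eu : sum_n u (S p) = Z).
  { unfold u, Z, sobolev_sq; rewrite sum_n_Rplus; f_equal; apply sum_n_ext; intros k;
      rewrite Derive_n_succ; reflexivity. }
  apply Rle_trans with (sum_n (fun k => (- c + C * N) * u k + C * N * (L * (L * Z))) (S p)).
  { apply sum_n_Rle; intros k Hk.
    eapply Rle_trans; [apply (H N _ r b Hn Pr Pb k Hk)|].
    rewrite HD; right; unfold u; ring. }
  rewrite sum_n_affine, Eu.
  replace ((- c + C * N) * Z + INR (S (S p)) * (C * N * (L * (L * Z))))
    with ((- c + K * N) * Z) by (unfold K; ring).
  apply Rmult_le_compat_r; [exact HZ|].
  assert (K * N <= c / 2); [|lra].
  apply Rle_trans with (K * (c / (2 * (K + 1)))); [apply Rmult_le_compat_l; lra|].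
  apply Rmult_le_reg_r with (2 * (K + 1)); [lra|].
  replace (K * (c / (2 * (K + 1))) * (2 * (K + 1))) with (K * c) by (field; lra).
  replace (c / 2 * (2 * (K + 1))) with (K * c + c) by field; lra.
Qed.

Lemma energy_estimate (p : nat) (L gamma B0 rhobar Bbar : R) :
  0 < L -> (1 <= p)%nat -> B0 <> 0 -> 0 < rhobar ->
  exists delta c K, 0 < delta /\ 0 < c /\ 0 < K /\ forall r b, smooth r -> smooth b ->
    torus_periodic L r -> torus_periodic L b -> RInt r 0 L = 0 -> RInt b 0 L = 0 ->
    energy L (Rpower rhobar (gamma - 2)) (S p) r b <= delta ->
    (exists D, near p rhobar
        (sqrt (K * energy L (Rpower rhobar (gamma - 2)) (S p) r b)) D r b) /\
    2 * sum_n (energy_flux L gamma B0 rhobar Bbar r b) (S p)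
      <= - c * energy L (Rpower rhobar (gamma - 2)) (S p) r b.
Proof.
  intros HL Hp HB H0.
  destruct (energy_flux_sum_bound p L gamma B0 rhobar Bbar HL Hp HB H0)
    as (eta & c & Heta & Hc & H).
  set (alpha := Rpower rhobar (gamma - 2)).
  assert (Ha : 0 < alpha) by apply exp_pos.
  assert (Ha' : 0 < / alpha) by (apply Rinv_0_lt_compat, Ha).
  set (K := 1 + / alpha); assert (HK : 0 < K) by (unfold K; lra).
  assert (HLK : 0 < L * K) by (apply Rmult_lt_0_compat; lra).
  assert (HL2 : 0 < L ^ 2) by (apply pow_lt, HL).
  assert (HaL : 0 < (alpha + 1) * L ^ 2) by (apply Rmult_lt_0_compat; lra).
  (* The unweighted squares add up to at most K E, so this threshold gives sqrt (L K E) <= eta. The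
     rate combines the doubled c with E <= (alpha + 1) L^2 Z, which is the Poincare inequality. *)
  exists (eta ^ 2 / (L * K)), (2 * c / ((alpha + 1) * L ^ 2)), (L * K).
  split; [apply Rdiv_lt_0_compat; [apply pow_lt, Heta|exact HLK]|].
  split; [apply Rdiv_lt_0_compat; lra|].
  split; [exact HLK|].
  intros r b Sr Sb Pr Pb Mr Mb HE.
  assert (Q1 := sobolev_sq_nonneg L (S p) r HL Sr).
  assert (Q2 := sobolev_sq_nonneg L (S p) b HL Sb).
  assert (Q3 := sobolev_sq_nonneg L (S p) (Derive r) HL (smooth_Derive _ Sr)).
  assert (Q4 := sobolev_sq_nonneg L (S p) (Derive b) HL (smooth_Derive _ Sb)).
  assert (P1 := poincare L (S p) r HL Sr Pr Mr).
  assert (P2 := poincare L (S p) b HL Sb Pb Mb).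
  set (E := energy L alpha (S p) r b) in *.
  assert (EE : E = alpha * sobolev_sq L (S p) r + sobolev_sq L (S p) b) by reflexivity.
  set (R0 := sobolev_sq L (S p) r) in *; set (R1 := sobolev_sq L (S p) b) in *.
  set (Z0 := sobolev_sq L (S p) (Derive r)) in *.
  set (Z1 := sobolev_sq L (S p) (Derive b)) in *.
  assert (HY : R0 + R1 <= K * E).
  { rewrite EE; unfold K.
    replace ((1 + / alpha) * (alpha * R0 + R1)) with (R0 + R1 + (alpha * R0 + / alpha * R1))
      by (field; lra).
    assert (0 <= alpha * R0) by (apply Rmult_le_pos; lra).
    assert (0 <= / alpha * R1) by (apply Rmult_le_pos; lra). lra. }
  assert (HS : sqrt (L * (K * E)) <= eta).
  { rewrite <- (sqrt_pow2 eta) by lra; apply sqrt_le_1_alt.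
    replace (eta ^ 2) with (L * K * (eta ^ 2 / (L * K))) by (field; split; lra).
    replace (L * (K * E)) with (L * K * E) by ring.
    apply Rmult_le_compat_l; lra. }
  destruct (H (K * E) r b Sr Sb Pr Pb Mr Mb HY HS) as [[D Hn] Hsum].
  split; [exists D; rewrite Rmult_assoc; exact Hn|].
  assert (HEZ : E <= (alpha + 1) * L ^ 2 * (Z0 + Z1)).
  { rewrite EE.
    assert (alpha * R0 <= alpha * (L ^ 2 * Z0)) by (apply Rmult_le_compat_l; lra).
    assert (0 <= alpha * (L ^ 2 * Z1)) by (repeat apply Rmult_le_pos; lra).
    assert (0 <= L ^ 2 * Z0) by (repeat apply Rmult_le_pos; lra). nra. }
  apply Rle_trans with (- (2 * c) * (Z0 + Z1)); [fold Z0 Z1 in Hsum; lra|].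
  apply Rmult_le_reg_l with ((alpha + 1) * L ^ 2); [exact HaL|].
  replace ((alpha + 1) * L ^ 2 * (- (2 * c / ((alpha + 1) * L ^ 2)) * E))
    with (- (2 * c) * E) by (field; split; lra).
  nra.
Qed.

(** * Time-dependent integrals *)

(* Freezing time at 0 for negative times makes one-sided continuity at 0
   two-sided. *)
Definition lifespan_continuous (T : Rbar) (F : R -> R -> R) : Prop :=
  forall t x, in_lifespan T t -> continuity_2d_pt (fun u v => F (Rmax u 0) v) t x.

Lemma lifespan_open (T : Rbar) (t : R) :
  Rbar_lt t T -> exists d : posreal, forall u, Rabs (u - t) < d -> Rbar_lt u T.
Proof.
  destruct T as [T| |]; simpl; intros H.
  - exists (mkposreal (T - t) ltac:(lra)); simpl; intros u Hu.
    apply Rabs_lt_between in Hu; lra.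
  - exists (mkposreal 1 Rlt_0_1); intros; exact I.
  - contradiction.
Qed.

Lemma in_lifespan_Rmax (T : Rbar) (t u : R) :
  in_lifespan T t -> Rbar_lt u T -> in_lifespan T (Rmax u 0).
Proof.
  intros [Ht HT] Hu; split; [apply Rmax_r|].
  unfold Rmax; destruct (Rle_dec u 0); [|exact Hu].
  apply Rbar_le_lt_trans with (Finite t); [exact Ht|exact HT].
Qed.

Lemma Rmax_dist_le (u t : R) : 0 <= t -> Rabs (Rmax u 0 - t) <= Rabs (u - t).
Proof.
  intros Ht; unfold Rmax; destruct (Rle_dec u 0); [|lra].
  rewrite !Rabs_left1; lra.
Qed.

Lemma lifespan_continuous_mult (T : Rbar) (F G : R -> R -> R) :
  lifespan_continuous T F -> lifespan_continuous T G ->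
  lifespan_continuous T (fun t x => F t x * G t x).
Proof. intros HF HG t x Ht; apply continuity_2d_pt_mult; auto. Qed.

Lemma lifespan_continuous_slice (T : Rbar) (F : R -> R -> R) (t x : R) :
  lifespan_continuous T F -> in_lifespan T t -> continuous (F t) x.
Proof.
  intros HF Ht; apply continuity_pt_filterlim; intros eps Heps.
  destruct (HF t x Ht (mkposreal eps Heps)) as [d Hd].
  exists d; split; [apply cond_pos|]; intros y [_ Hy].
  rewrite <- (Rmax_left t 0) by apply Ht.
  apply Hd; [rewrite Rminus_diag, Rabs_R0; apply cond_pos|exact Hy].
Qed.

Lemma ex_RInt_lifespan (T : Rbar) (F : R -> R -> R) (t L : R) :
  lifespan_continuous T F -> in_lifespan T t -> ex_RInt (F t) 0 L.
Proof. intros HF Ht; apply ex_RInt_cont; intros; eapply lifespan_continuous_slice; eassumption. Qed.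

(** Uniform continuity over the compact interval [0, L] brings the integrands within eps / (2 L),
    hence the integrals within eps / 2. *)
Lemma RInt_lifespan_continuous (T : Rbar) (L : R) (F : R -> R -> R) (t : R) :
  0 < L -> lifespan_continuous T F -> in_lifespan T t ->
  continuity_pt (fun u => RInt (F (Rmax u 0)) 0 L) t.
Proof.
  intros HL HF Ht eps Heps.
  destruct (lifespan_open T t (proj2 Ht)) as [d0 Hd0].
  destruct (uniform_continuity_2d_1d' (fun u v => F (Rmax u 0) v) 0 L t
             (fun x _ => HF t x Ht) (mkposreal (eps / (2 * L)) ltac:(apply Rdiv_lt_0_compat; lra)))
    as [d Hd].
  exists (Rmin d0 d); split; [apply Rmin_glb_lt; apply cond_pos|].
  intros u [_ Hu]; unfold R_dist in Hu |- *; simpl in Hu |- *; unfold Rdist in Hu |- *.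
  assert (Hu1 : Rabs (u - t) < d0) by (eapply Rlt_le_trans; [exact Hu|apply Rmin_l]).
  assert (Hu2 : Rabs (u - t) < d) by (eapply Rlt_le_trans; [exact Hu|apply Rmin_r]).
  assert (Cu : forall x, continuous (F (Rmax u 0)) x).
  { intros x; apply (lifespan_continuous_slice T); [exact HF|].
    eapply in_lifespan_Rmax; [exact Ht|apply Hd0, Hu1]. }
  assert (Ct : forall x, continuous (F (Rmax t 0)) x).
  { intros x; apply (lifespan_continuous_slice T); [exact HF|].
    eapply in_lifespan_Rmax; [exact Ht|apply Ht]. }
  replace (RInt (F (Rmax u 0)) 0 L - RInt (F (Rmax t 0)) 0 L)
    with (RInt (fun x => F (Rmax u 0) x + -1 * F (Rmax t 0) x) 0 L).
  - apply Rle_lt_trans with ((L - 0) * (eps / (2 * L))).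
    + apply abs_RInt_le_const; [lra| |].
      * apply ex_RInt_cont; intros x.
        apply (continuous_plus (V := R_NormedModule)); [apply Cu|].
        apply continuous_Rmult; [apply continuous_const|apply Ct].
      * intros x Hx; left; replace (F (Rmax u 0) x + -1 * F (Rmax t 0) x)
          with (F (Rmax u 0) x - F (Rmax t 0) x) by ring.
        assert (P := cond_pos d); apply Rabs_lt_between in Hu2.
        apply Hd; try assumption; try lra; rewrite Rminus_diag, Rabs_R0; exact P.
    + replace ((L - 0) * (eps / (2 * L))) with (eps / 2) by (field; lra); lra.
  - rewrite RInt_Rplus, RInt_Rscal; [|exact Ct|exact Cu|].
    { match goal with |- ?a = ?b => change (@eq R a b) end; ring. }
    intros x; apply continuous_Rmult; [apply continuous_const|apply Ct].
Qed.

Lemma RInt_lifespan_derive (T : Rbar) (L : R) (F G : R -> R -> R) (t : R) :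
  0 < L -> lifespan_continuous T F -> lifespan_continuous T G ->
  (forall u x, 0 < u -> Rbar_lt u T -> is_derive (fun tau => F tau x) u (G u x)) ->
  0 < t -> Rbar_lt t T ->
  is_derive (fun u => RInt (F (Rmax u 0)) 0 L) t (RInt (G t) 0 L).
Proof.
  intros HL HF HG HD H0 HT.
  assert (Ht : in_lifespan T t) by (split; [lra|exact HT]).
  destruct (lifespan_open T t HT) as [d0 Hd0].
  (* Within this radius the times stay in (0, T), where freezing has no effect and [F] is
     differentiable in time. *)
  set (d := mkposreal (Rmin d0 t) (Rmin_glb_lt _ _ _ (cond_pos d0) H0)).
  assert (Near : forall u, Rabs (u - t) < d -> 0 < u /\ Rbar_lt u T).
  { intros u Hu; split; [|apply Hd0; eapply Rlt_le_trans; [exact Hu|apply Rmin_l]].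
    assert (Rabs (u - t) < t) by (eapply Rlt_le_trans; [exact Hu|apply Rmin_r]).
    apply Rabs_lt_between in H; lra. }
  assert (NearD : forall u x, 0 < u /\ Rbar_lt u T ->
    is_derive (fun tau => F (Rmax tau 0) x) u (G u x)).
  { intros u x [Hu HuT]; apply (is_derive_ext_loc (fun tau => F tau x)).
    - exists (mkposreal u Hu); intros y Hy; change (Rabs (y - u) < u) in Hy.
      apply Rabs_lt_between in Hy; rewrite Rmax_left by lra; reflexivity.
    - apply HD; assumption. }
  assert (NearE : forall u x, 0 < u /\ Rbar_lt u T ->
    Derive (fun tau => F (Rmax tau 0) x) u = G u x).
  { intros u x Hu; apply is_derive_unique, NearD, Hu. }
  rewrite (RInt_ext (G t) (fun x => Derive (fun tau => F (Rmax tau 0) x) t))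
    by (intros x _; symmetry; apply NearE; split; assumption).
  apply (is_derive_RInt_param (fun u x => F (Rmax u 0) x)).
  - exists d; intros u Hu x _; eexists; apply NearD, Near, Hu.
  - intros x _; apply continuity_2d_pt_ext_loc with (2 := HG t x Ht).
    exists d; intros u v Hu _; rewrite NearE by (apply Near, Hu).
    rewrite Rmax_left by (apply Rlt_le, Near, Hu); reflexivity.
  - exists d; intros u Hu; apply (ex_RInt_lifespan T F); [exact HF|].
    eapply in_lifespan_Rmax; [exact Ht|apply Near, Hu].
Qed.

(** [smooth_on_lifespan] identifies a function with its family of derivatives only inside the
    lifespan; an open neighbourhood of t suffices to transfer the time derivative. *)
Lemma lifespan_Derive (T : Rbar) (f g : R -> R) (t l : R) :
  (forall u, in_lifespan T u -> g u = f u) -> 0 < t -> Rbar_lt t T ->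
  is_derive g t l -> Derive f t = l.
Proof.
  intros Hfg Ht HT Hg; apply is_derive_unique.
  apply (is_derive_ext_loc g); [|exact Hg].
  destruct (lifespan_open T t HT) as [e He].
  exists (mkposreal (Rmin e t) (Rmin_glb_lt _ _ _ (cond_pos e) Ht)).
  intros u Hu; change (Rabs (u - t) < Rmin e t) in Hu; apply Hfg; split.
  - assert (B : Rabs (u - t) < t) by (eapply Rlt_le_trans; [exact Hu|apply Rmin_r]).
    apply Rabs_lt_between in B; lra.
  - apply He; eapply Rlt_le_trans; [exact Hu|apply Rmin_l].
Qed.

Lemma smooth_of_derivatives (e : nat -> R -> R) :
  (forall j x, is_derive (e j) x (e (S j) x)) ->
  smooth (e 0%nat) /\ forall j, Derive_n (e 0%nat) j = e j.
Proof.
  intros H.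
  assert (E : forall j, Derive_n (e 0%nat) j = e j).
  { induction j as [|j IH]; [reflexivity|].
    apply functional_extensionality; intros x; simpl; rewrite IH.
    apply is_derive_unique, H. }
  split; [|exact E].
  intros [|j] x; [exact I|]; simpl; rewrite E; eexists; apply H.
Qed.

Lemma smooth_on_lifespan_plus_const (T : Rbar) (c : R) (f : R -> R -> R) :
  smooth_on_lifespan T f -> smooth_on_lifespan T (fun t x => f t x - c).
Proof.
  intros (d & H0 & H1 & H2 & H3).
  (* Subtracting a constant alters only the entry (0, 0) of the family of derivatives. *)
  set (k := fun i j => match i, j with O, O => - c | _, _ => 0 end).
  assert (Ek : forall u v w, is_derive u v w -> forall a : R,
    is_derive (fun y => u y + a) v (w + 0)).
  { intros u v w Hu a.
    apply (is_derive_plus (V := R_NormedModule) u (fun _ => a)); [exact Hu|].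
    apply (is_derive_const (V := R_NormedModule)). }
  exists (fun i j t x => d i j t x + k i j); split; [|split; [|split]].
  - intros t x Ht; simpl; rewrite H0 by exact Ht; ring.
  - intros i j t x Ht HT; simpl; apply Ek, H1; assumption.
  - intros i j t x Ht; replace (k i (S j)) with 0 by (destruct i; reflexivity).
    apply Ek, H2, Ht.
  - intros i j t x Ht.
    eapply filterlim_comp_2; [exact (H3 i j t x Ht)|exact (filterlim_const (k i j))|].
    exact (filterlim_plus (V := R_NormedModule) (d i j t x) (k i j)).
Qed.

(** The map from (u, v) to (max(u, 0), v) lands in the closed half-plane and does not increase the
    distance to a point with t >= 0, so the limit within the half-plane pulls back to a full
    limit. *)
Lemma smooth_on_lifespan_extend (T : Rbar) (d : nat -> nat -> R -> R -> R) :
  (forall i j t x, in_lifespan T t ->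
     filterlim (fun p : R * R => d i j (fst p) (snd p))
       (within (fun p : R * R => 0 <= fst p) (locally (t, x)))
       (locally (d i j t x))) ->
  forall i j, lifespan_continuous T (d i j).
Proof.
  intros H3 i j t x Ht; apply continuity_2d_pt_filterlim.
  rewrite (Rmax_left t 0) by apply Ht.
  apply (filterlim_comp _ _ _ (fun z : R * R => (Rmax (fst z) 0, snd z))
    (fun p => d i j (fst p) (snd p)) _ _ _ ) with (2 := H3 i j t x Ht).
  intros P [e He]; exists e; intros z [Hz1 Hz2].
  apply He; [|apply Rmax_r]; split; [|exact Hz2].
  change (Rabs (Rmax (fst z) 0 - t) < e).
  eapply Rle_lt_trans; [apply Rmax_dist_le, Ht|exact Hz1].
Qed.

Lemma smooth_on_lifespan_slice (T : Rbar) (f : R -> R -> R) (t : R) :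
  smooth_on_lifespan T f -> in_lifespan T t -> smooth (f t).
Proof.
  intros (d & H0 & _ & H2 & _) Ht.
  replace (f t) with (d 0%nat 0%nat t)
    by (apply functional_extensionality; intros; apply H0, Ht).
  apply (smooth_of_derivatives (fun j => d 0%nat j t)); intros; apply H2, Ht.
Qed.

Lemma smooth_on_lifespan_l2sq (T : Rbar) (L : R) (f : R -> R -> R) (k : nat) :
  0 < L -> smooth_on_lifespan T f ->
  (forall t, in_lifespan T t ->
    continuity_pt (fun u => l2sq L (Derive_n (f (Rmax u 0)) k)) t) /\
  (forall t, 0 < t -> Rbar_lt t T ->
    is_derive (fun u => l2sq L (Derive_n (f (Rmax u 0)) k)) t
      (2 * RInt (fun x => Derive_n (f t) k x
                   * Derive_n (fun y => Derive (fun tau => f tau y) t) k x) 0 L)).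
Proof.
  intros HL (d & H0 & H1 & H2 & H3).
  assert (HC := smooth_on_lifespan_extend T d H3).
  assert (E0 : forall t, in_lifespan T t -> Derive_n (f t) k = d 0%nat k t).
  { intros t Ht; replace (f t) with (d 0%nat 0%nat t)
      by (apply functional_extensionality; intros; apply H0, Ht).
    apply (smooth_of_derivatives (fun j => d 0%nat j t)); intros; apply H2, Ht. }
  (* [d 1 k] is both the time derivative of [d 0 k] and the k-th space derivative of [d 1 0], so the
     family itself encodes the exchange of time and space derivatives. *)
  assert (E1 : forall t, 0 < t -> Rbar_lt t T ->
    Derive_n (fun y => Derive (fun tau => f tau y) t) k = d 1%nat k t).
  { intros t Ht HT.
    replace (fun y => Derive (fun tau => f tau y) t) with (d 1%nat 0%nat t).
    - apply (smooth_of_derivatives (fun j => d 1%nat j t)); intros; apply H2.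
      split; [lra|exact HT].
    - apply functional_extensionality; intros y; symmetry.
      apply (lifespan_Derive T _ (fun tau => d 0%nat 0%nat tau y)); try assumption;
        [intros; apply H0; assumption|apply H1; assumption]. }
  assert (CF : lifespan_continuous T (fun t x => d 0%nat k t x * d 0%nat k t x))
    by (apply lifespan_continuous_mult; apply HC).
  assert (CG : lifespan_continuous T (fun t x => d 0%nat k t x * d 1%nat k t x))
    by (apply lifespan_continuous_mult; apply HC).
  assert (CG2 : lifespan_continuous T (fun t x => 2 * (d 0%nat k t x * d 1%nat k t x))).
  { apply lifespan_continuous_mult with (F := fun _ _ => 2); [|exact CG].
    intros t x _; apply continuity_2d_pt_const. }
  assert (EF : forall u, in_lifespan T u ->
    l2sq L (Derive_n (f u) k) = RInt (fun x => d 0%nat k u x * d 0%nat k u x) 0 L).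
  { intros u Hu; rewrite l2sq_square, E0 by exact Hu; reflexivity. }
  assert (ELoc : forall t, in_lifespan T t -> locally t (fun u =>
    RInt (fun x => d 0%nat k (Rmax u 0) x * d 0%nat k (Rmax u 0) x) 0 L
    = l2sq L (Derive_n (f (Rmax u 0)) k))).
  { intros t Ht; destruct (lifespan_open T t (proj2 Ht)) as [e He].
    exists e; intros u Hu; symmetry; apply EF.
    eapply in_lifespan_Rmax; [exact Ht|apply He, Hu]. }
  split.
  - intros t Ht; apply (continuity_pt_ext_loc _ _ _ (ELoc t Ht)).
    apply (RInt_lifespan_continuous T L _ t HL CF Ht).
  - intros t Ht HT; assert (Ht' : in_lifespan T t) by (split; [lra|exact HT]).
    apply (is_derive_ext_loc _ _ _ _ (ELoc t Ht')).
    rewrite E0, E1 by assumption.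
    rewrite <- RInt_Rscal by (intros; exact (lifespan_continuous_slice T _ t x CG Ht')).
    apply (RInt_lifespan_derive T L _ _ t HL CF CG2); try assumption.
    intros u x Hu HuT.
    replace (2 * (d 0%nat k u x * d 1%nat k u x))
      with (d 1%nat k u x * d 0%nat k u x + d 0%nat k u x * d 1%nat k u x) by ring.
    apply (is_derive_mult (fun tau => d 0%nat k tau x) (fun tau => d 0%nat k tau x));
      [apply H1; assumption|apply H1; assumption|intros; apply Rmult_comm].
Qed.

Lemma smooth_on_lifespan_integral (T : Rbar) (L : R) (f : R -> R -> R) :
  0 < L -> smooth_on_lifespan T f ->
  (forall t, 0 < t -> Rbar_lt t T -> RInt (fun y => Derive (fun tau => f tau y) t) 0 L = 0) ->
  forall t, in_lifespan T t -> RInt (f t) 0 L = RInt (f 0) 0 L.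
Proof.
  intros HL (d & H0 & H1 & H2 & H3) Hz t Ht.
  assert (HC := smooth_on_lifespan_extend T d H3).
  assert (E0 : forall t, in_lifespan T t -> f t = d 0%nat 0%nat t)
    by (intros; apply functional_extensionality; intros; symmetry; apply H0; assumption).
  assert (Hlt : forall u, 0 <= u <= t -> in_lifespan T u).
  { intros u Hu; split; [lra|].
    apply Rbar_le_lt_trans with (Finite t); [simpl; lra|apply Ht]. }
  assert (Hz' : forall u, 0 < u -> Rbar_lt u T -> RInt (d 1%nat 0%nat u) 0 L = 0).
  { intros u Hu HuT; eapply eq_trans; [|exact (Hz u Hu HuT)]; f_equal.
    apply functional_extensionality; intros y; symmetry.
    apply (lifespan_Derive T _ (fun tau => d 0%nat 0%nat tau y)); try assumption;
      [intros; apply H0; assumption|apply H1; assumption]. }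
  destruct (MVT_gen (fun u => RInt (d 0%nat 0%nat (Rmax u 0)) 0 L) 0 t (fun _ => 0))
    as (c & _ & E).
  - rewrite Rmin_left, Rmax_right by apply Ht; intros u Hu.
    destruct (Hlt u ltac:(lra)) as [_ HuT].
    assert (P := RInt_lifespan_derive T L _ _ u HL (HC 0%nat 0%nat) (HC 1%nat 0%nat)
                   (fun v x => H1 0%nat 0%nat v x) (proj1 Hu) HuT).
    rewrite (Hz' u (proj1 Hu) HuT) in P; exact P.
  - rewrite Rmin_left, Rmax_right by apply Ht; intros u Hu.
    apply (RInt_lifespan_continuous T L _ u HL (HC 0%nat 0%nat)), Hlt, Hu.
  - rewrite !Rmax_left in E by (try apply Ht; lra).
    rewrite (E0 t), (E0 0) by (apply Hlt; destruct Ht; lra). lra.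
Qed.

(** * Bootstrap and decay *)

Lemma nonincreasing_of_derive (f : R -> R) (a b : R) :
  a <= b -> (forall x, a <= x <= b -> continuity_pt f x) ->
  (forall x, a < x < b -> exists l, is_derive f x l /\ l <= 0) -> f b <= f a.
Proof.
  intros Hab Hc Hd.
  (* [MVT_gen] may return an endpoint, where the derivative is replaced by 0. *)
  set (df := fun x => if Rlt_dec a x then if Rlt_dec x b then Derive f x else 0 else 0).
  assert (Hdf : forall x, df x <= 0).
  { intros x; unfold df; destruct (Rlt_dec a x); [|lra]; destruct (Rlt_dec x b); [|lra].
    destruct (Hd x) as (l & Hl & Hl0); [lra|].
    rewrite (is_derive_unique _ _ _ Hl); exact Hl0. }
  destruct (MVT_gen f a b df) as (c & _ & E).
  - rewrite Rmin_left, Rmax_right by exact Hab; intros x Hx.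
    unfold df; destruct (Rlt_dec a x); [|lra]; destruct (Rlt_dec x b); [|lra].
    destruct (Hd x Hx) as (l & Hl & _); apply Derive_correct; exists l; exact Hl.
  - rewrite Rmin_left, Rmax_right by exact Hab; exact Hc.
  - assert (H := Hdf c); nra.
Qed.

Lemma in_lifespan_le (T : Rbar) (t u : R) :
  in_lifespan T t -> 0 <= u <= t -> in_lifespan T u.
Proof.
  intros [Ht HT] Hu; split; [lra|].
  apply Rbar_le_lt_trans with (Finite t); [simpl; lra|exact HT].
Qed.

(** Monotonicity is known only while E <= delta, the very bound to be shown. Up to the supremum s of
    the good times E does not increase, so E s <= E 0 < delta, and the strict inequality together
    with continuity extends past s. *)
Lemma bootstrap (T : Rbar) (E : R -> R) (delta : R) :
  (forall t, in_lifespan T t -> continuity_pt E t) ->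
  (forall t, 0 < t -> Rbar_lt t T -> E t <= delta -> exists l, is_derive E t l /\ l <= 0) ->
  E 0 < delta -> forall t, in_lifespan T t -> E t < delta.
Proof.
  intros Hc Hd H0 t Ht.
  destruct (Rlt_le_dec (E t) delta) as [|Hbad]; [assumption|exfalso].
  set (A := fun u => 0 <= u <= t /\ forall v, 0 <= v <= u -> E v < delta).
  destruct (completeness A) as [s [Hub Hlub]].
  - exists t; intros u [Hu _]; lra.
  - exists 0; split; [split; [lra|apply Ht]|].
    intros v Hv; replace v with 0 by lra; exact H0.
  - assert (Hs0 : 0 <= s).
    { apply Hub; split; [split; [lra|apply Ht]|].
      intros v Hv; replace v with 0 by lra; exact H0. }
    assert (Hst : s <= t) by (apply Hlub; intros u [Hu _]; lra).
    assert (Hbelow : forall v, 0 <= v < s -> E v < delta).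
    { intros v Hv; destruct (Rlt_le_dec (E v) delta) as [|Hv']; [assumption|].
      assert (s <= v); [|lra]; apply Hlub; intros u [Hu HA].
      destruct (Rle_lt_dec u v) as [|Huv]; [assumption|].
      assert (E v < delta) by (apply HA; lra); lra. }
    assert (HEs : E s < delta).
    { apply Rle_lt_trans with (E 0); [|exact H0].
      apply nonincreasing_of_derive; [exact Hs0| |].
      - intros x Hx; apply Hc, (in_lifespan_le T t); [exact Ht|lra].
      - intros x Hx; apply Hd; [lra| |].
        + apply (in_lifespan_le T t); [exact Ht|lra].
        + left; apply Hbelow; lra. }
    destruct (Hc s (in_lifespan_le T t s Ht (conj Hs0 Hst)) (delta - E s)) as (d & Hd0 & Hnear);
      [lra|].
    assert (HE : forall v, 0 <= v -> v < s + d -> E v < delta).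
    { intros v Hv Hvd; destruct (Rlt_le_dec v s) as [|Hvs]; [apply Hbelow; lra|].
      destruct (Req_dec v s) as [->|Hne]; [exact HEs|].
      assert (K : Rabs (E v - E s) < delta - E s).
      { apply (Hnear v); split; [split; [exact I|intros e; apply Hne; symmetry; exact e]|].
        simpl; unfold Rdist; rewrite Rabs_pos_eq; lra. }
      apply Rabs_lt_between in K; lra. }
    destruct (Rle_lt_or_eq_dec s t Hst) as [Hlt|Heq].
    + assert (K : Rmin t (s + d / 2) <= s).
      { apply Hub; split.
        - split; [apply Rmin_glb; lra|apply Rmin_l].
        - intros v Hv; apply HE; [lra|].
          assert (v <= s + d / 2) by (eapply Rle_trans; [apply Hv|apply Rmin_r]); lra. }
      assert (s < Rmin t (s + d / 2)) by (apply Rmin_glb_lt; lra); lra.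
    + rewrite Heq in HEs; lra.
Qed.

Lemma bootstrap_decay (T : Rbar) (E : R -> R) (delta c : R) :
  0 < c -> (forall t, in_lifespan T t -> continuity_pt E t) ->
  (forall t, in_lifespan T t -> 0 <= E t) ->
  (forall t, 0 < t -> Rbar_lt t T -> E t <= delta ->
     exists l, is_derive E t l /\ l <= - c * E t) ->
  E 0 < delta ->
  forall t, in_lifespan T t -> E t <= delta /\ E t <= E 0 * exp (- c * t).
Proof.
  intros Hc0 Hc Hp Hd H0 t Ht.
  assert (Hlt : forall u, in_lifespan T u -> E u < delta).
  { apply bootstrap; try assumption; intros u Hu HuT HE.
    destruct (Hd u Hu HuT HE) as (l & Hl & Hle); exists l; split; [exact Hl|].
    assert (0 <= E u) by (apply Hp; split; [lra|exact HuT]); nra. }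
  split; [left; apply Hlt, Ht|].
  (* Gronwall's argument: with the integrating factor exp (c t) the energy is nonincreasing. *)
  assert (HF : E t * exp (c * t) <= E 0 * exp (c * 0)).
  { assert (De : forall x, is_derive (fun u => exp (c * u)) x (c * exp (c * x))).
    { intros x; auto_derive; [exact I|ring]. }
    apply (nonincreasing_of_derive (fun u => E u * exp (c * u)) 0 t (proj1 Ht)).
    - intros x Hx; apply continuity_pt_mult.
      + apply Hc, (in_lifespan_le T t); [exact Ht|lra].
      + apply derivable_continuous_pt; exists (c * exp (c * x)); apply is_derive_Reals, De.
    - intros x Hx.
      assert (Hx' : in_lifespan T x) by (apply (in_lifespan_le T t); [exact Ht|lra]).
      destruct (Hd x (proj1 Hx) (proj2 Hx') (Rlt_le _ _ (Hlt x Hx'))) as (l & Hl & Hle).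
      exists (l * exp (c * x) + E x * (c * exp (c * x))); split.
      + apply (is_derive_mult E (fun u => exp (c * u)) x l (c * exp (c * x)) Hl (De x)).
        intros; apply Rmult_comm.
      + assert (P := exp_pos (c * x)).
        replace (l * exp (c * x) + E x * (c * exp (c * x)))
          with ((l - - c * E x) * exp (c * x)) by ring.
        nra. }
  rewrite Rmult_0_r, exp_0, Rmult_1_r in HF.
  replace (- c * t) with (- (c * t)) by ring; rewrite exp_Ropp.
  apply Rmult_le_reg_r with (exp (c * t)); [apply exp_pos|].
  rewrite Rmult_assoc, Rinv_l by (apply Rgt_not_eq, exp_pos); lra.
Qed.

(** * From sup bounds back to Sobolev and dual norms *)

Lemma sobolev_norm_le (L M : R) (m : nat) (f : R -> R) :
  0 < L -> smooth f -> dbound m M f ->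
  sobolev_norm L m f <= sqrt (INR (S m) * L) * M.
Proof.
  intros HL Sf Hf; assert (HM := dbound_nonneg _ _ _ Hf).
  change (sqrt (sobolev_sq L m f) <= sqrt (INR (S m) * L) * M).
  rewrite <- (sqrt_pow2 M HM) at 1.
  assert (HI : 0 <= INR (S m) * L) by (apply Rmult_le_pos; [apply pos_INR|lra]).
  rewrite <- sqrt_mult by (try assumption; apply pow2_ge_0).
  apply sqrt_le_1_alt; rewrite Rmult_assoc, <- (sum_n_Rconst (L * M ^ 2)).
  apply sum_n_Rle; intros k Hk; apply l2sq_le_sup; [exact HL| |].
  - intros; apply smooth_continuous; smooth_tac.
  - intros x; rewrite <- (pow2_abs (Derive_n f k x)).
    apply pow_incr; split; [apply Rabs_pos|apply Hf, Hk].
Qed.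

Lemma sobolev_dual_norm_le (L M : R) (k : nat) (f : R -> R) :
  0 < L -> (forall x, continuous f x) -> (forall x, Rabs (f x) <= M) ->
  0 <= sobolev_dual_norm L k f <= sqrt L * M.
Proof.
  intros HL Cf HM.
  assert (HM0 : 0 <= M) by (eapply Rle_trans; [apply Rabs_pos|apply (HM 0)]).
  unfold sobolev_dual_norm.
  set (A := fun r : R => exists phi : R -> R, torus_smooth L phi /\ sobolev_norm L k phi <= 1 /\
    (r : R) = RInt (fun x => f x * phi x) 0 L).
  destruct (Lub_Rbar_correct A) as [Hub Hlub].
  (* The zero test function excludes a supremum of minus infinity and [AB] excludes plus infinity,
     so [real] returns the true supremum and not its default 0. *)
  assert (A0 : A 0).
  { exists (fun _ => 0); split; [|split].
    - split; [intros x; reflexivity|exact (smooth_const 0)].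
    - eapply Rle_trans.
      + apply (sobolev_norm_le L (Rabs 0) k (fun _ => 0) HL (smooth_const 0)), dbound_const.
      + rewrite Rabs_R0, Rmult_0_r; lra.
    - rewrite (RInt_ext _ (fun _ => 0)) by (intros; apply Rmult_0_r).
      rewrite RInt_Rconst; symmetry; apply Rmult_0_r. }
  assert (AB : is_ub_Rbar A (sqrt L * M)).
  { intros r (phi & [Pphi Sphi] & Hphi & ->); simpl.
    assert (Cphi : forall x, continuous phi x)
      by (intros; apply smooth_continuous; exact Sphi).
    assert (CS := Cauchy_Schwarz f phi 0 L (Rlt_le _ _ HL) Cf Cphi).
    rewrite <- !l2sq_square in CS.
    assert (B1 : l2sq L f <= L * M ^ 2).
    { apply l2sq_le_sup; [exact HL|exact Cf|]; intros x; rewrite <- (pow2_abs (f x)).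
      apply pow_incr; split; [apply Rabs_pos|apply HM]. }
    assert (B2 : l2sq L phi <= 1).
    { eapply Rle_trans; [exact (l2sq_Derive_n_le L k 0 phi HL Sphi (Nat.le_0_l k))|].
      assert (Q := sobolev_sq_nonneg L k phi HL Sphi).
      rewrite <- (pow2_sqrt _ Q); change (sqrt (sobolev_sq L k phi)) with (sobolev_norm L k phi).
      rewrite <- (pow1 2); apply pow_incr; split; [apply sqrt_pos|exact Hphi]. }
    assert (Q1 := l2sq_nonneg L f HL Cf); assert (Q2 := l2sq_nonneg L phi HL Cphi).
    set (r := RInt (fun x => f x * phi x) 0 L) in *.
    assert (B3 : r ^ 2 <= L * M ^ 2).
    { eapply Rle_trans; [exact CS|]; nra. }
    eapply Rle_trans; [apply Rle_abs|]; rewrite <- sqrt_Rsqr_abs, Rsqr_pow2.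
    rewrite <- (sqrt_pow2 M HM0), <- sqrt_mult by (try apply pow2_ge_0; lra).
    apply sqrt_le_1_alt, B3. }
  assert (H1 := Hub 0 A0); assert (H2 := Hlub _ AB).
  destruct (Lub_Rbar A) as [l| |]; simpl in H1, H2; [split; assumption|contradiction|contradiction].
Qed.

(** The range starts at -1 because the velocity is measured in H^(m-1) with m = 0 allowed; there the
    sup norm bounds the dual norm. *)
Lemma Hnorm_le (L M : R) (q : nat) (z : Z) (f : R -> R) :
  0 < L -> (-1 <= z <= Z.of_nat q)%Z -> smooth f -> dbound q M f ->
  0 <= Hnorm L z f <= sqrt (INR (S q) * L) * M.
Proof.
  intros HL Hz Sf Hf; assert (HM := dbound_nonneg _ _ _ Hf).
  assert (K : forall m, (m <= q)%nat ->
    0 <= sobolev_norm L m f <= sqrt (INR (S q) * L) * M).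
  { intros m Hm; split; [apply sqrt_pos|].
    eapply Rle_trans; [apply (sobolev_norm_le L M m f HL Sf)|].
    - apply dbound_le with (3 := Hf); [exact Hm|lra].
    - apply Rmult_le_compat_r; [exact HM|]; apply sqrt_le_1_alt.
      apply Rmult_le_compat_r; [lra|]; apply le_INR; lia. }
  destruct z as [|p|p]; [apply K; lia|apply K; lia|].
  destruct (sobolev_dual_norm_le L M (Pos.to_nat p) f HL) as [H1 H2].
  - intros; apply smooth_continuous, Sf.
  - intros x; apply (Hf 0%nat x); lia.
  - split; [exact H1|]; eapply Rle_trans; [exact H2|].
    apply Rmult_le_compat_r; [exact HM|]; apply sqrt_le_1_alt.
    rewrite <- (Rmult_1_l L) at 1; apply Rmult_le_compat_r; [lra|].
    replace 1 with (INR 1) by reflexivity; apply le_INR; lia.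
Qed.

Lemma is_lim_0_of_exp_bound (f : R -> R) (A c : R) :
  0 < c -> (forall t, 0 <= t -> 0 <= f t <= A * exp (- c * t)) -> is_lim f p_infty 0.
Proof.
  intros Hc Hf.
  apply (is_lim_le_le_loc (fun _ => 0) (fun t => A * exp (- c * t))).
  - exists 0; intros t Ht; apply Hf; lra.
  - apply is_lim_const.
  - replace (Finite 0) with (Rbar_mult A (Finite 0)) by (simpl; f_equal; ring).
    apply is_lim_scal_l.
    apply (is_lim_comp exp (fun t => - c * t) p_infty 0 m_infty is_lim_exp_m).
    + replace m_infty with (Rbar_mult (- c) p_infty).
      * apply is_lim_scal_l, is_lim_id.
      * simpl; destruct (Rle_dec 0 (- c)) as [h|h]; [exfalso; lra|reflexivity].
    + exists 0; intros; discriminate.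
Qed.

(** The velocity components have this form. The coefficients are merely bounded; the factor N comes
    from [Derive r] and [Derive b], at the price of one order. *)
Lemma flux_combination_dbound (q : nat) (rhobar fbar gbar : R) F G :
  admissible (S q) rhobar fbar F -> admissible (S q) rhobar gbar G ->
  exists C, 0 <= C /\ forall N D r b, near (S q) rhobar N D r b ->
    smooth (fun x => F r b x * Derive r x + G r b x * Derive b x) /\
    dbound q (C * N) (fun x => F r b x * Derive r x + G r b x * Derive b x).
Proof.
  intros HF HG.
  destruct (dbound_admissible _ _ _ _ HF) as (M & HM & BF).
  destruct (dbound_admissible _ _ _ _ HG) as (M' & HM' & BG).
  exists (2 ^ q * M + 2 ^ q * M'); split.
  { assert (0 <= 2 ^ q) by (apply pow_le; lra); nra. }
  intros N D r b Hn.
  destruct (BF N D r b Hn) as [SF DF]; destruct (BG N D r b Hn) as [SG DG].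
  destruct Hn as (HN & HN' & HD & Sr & Sb & R1 & _ & B1 & _).
  split; [smooth_tac|].
  replace ((2 ^ q * M + 2 ^ q * M') * N) with (2 ^ q * (M * N) + 2 ^ q * (M' * N)) by ring.
  apply dbound_plus; [smooth_tac|smooth_tac| |]; apply dbound_mult; try assumption;
    try smooth_tac; try (apply dbound_Derive; assumption);
    (apply dbound_le with (3 := DF) || apply dbound_le with (3 := DG)); try lia; lra.
Qed.

(** * Solutions of the system *)

Lemma smooth_minus_const (c : R) (f : R -> R) : smooth f -> smooth (fun x => f x - c).
Proof. intros Sf; exact (smooth_plus f (fun _ => - c) Sf (smooth_const (- c))). Qed.

Lemma flux_rho_smooth (gamma rhobar Bbar : R) (r b : R -> R) :
  smooth r -> smooth b -> (forall x, 0 < rhobar + r x) ->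
  smooth (flux_rho gamma rhobar Bbar r b).
Proof. intros Sr Sb Hp; unfold flux_rho; smooth_tac. Qed.

Lemma flux_B_smooth (gamma B0 rhobar Bbar : R) (r b : R -> R) :
  smooth r -> smooth b -> (forall x, 0 < rhobar + r x) ->
  smooth (flux_B gamma B0 rhobar Bbar r b).
Proof. intros Sr Sb Hp; unfold flux_B; smooth_tac. Qed.

Lemma Derive_total_pressure (gamma rhobar Bbar : R) (r b : R -> R) :
  gamma <> 0 -> smooth r -> smooth b -> (forall x, 0 < rhobar + r x) ->
  Derive (fun x => / gamma * Rpower (rhobar + r x) gamma + / 2 * (Bbar + b x) ^ 2)
  = flux_rho gamma rhobar Bbar r b.
Proof.
  intros Hg Sr Sb Hp.
  replace (fun x => / gamma * Rpower (rhobar + r x) gamma + / 2 * (Bbar + b x) ^ 2)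
    with (fun x => / gamma * Rpower (rhobar + r x) gamma
                   + / 2 * ((Bbar + b x) * (Bbar + b x)))
    by (apply functional_extensionality; intros; simpl; rewrite Rmult_1_r; reflexivity).
  assert (Sr' : smooth (fun x => rhobar + r x)) by smooth_tac.
  assert (Sb' : smooth (fun x => Bbar + b x)) by smooth_tac.
  apply functional_extensionality; intros x.
  rewrite Derive_plus by (apply smooth_ex_derive; smooth_tac).
  rewrite !Derive_scal.
  rewrite Derive_Rpower_smooth, Derive_mult_smooth, !Derive_plus_const by assumption.
  unfold flux_rho; field; exact Hg.
Qed.

Lemma flux_B_eq (gamma B0 rhobar Bbar : R) (r b : R -> R) (x : R) :
  0 < rhobar + r x ->
  (Bbar + b x) / (rhobar + r x) * flux_rho gamma rhobar Bbar r b x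
  + B0 ^ 2 / (rhobar + r x) * Derive b x
  = flux_B gamma B0 rhobar Bbar r b x.
Proof.
  intros Hp; unfold flux_rho, flux_B.
  assert (E1 : Rpower (rhobar + r x) (gamma - 1)
               = Rpower (rhobar + r x) (gamma - 2) * (rhobar + r x)).
  { rewrite <- (Rpower_1 (rhobar + r x) Hp) at 3; rewrite <- Rpower_plus; f_equal; ring. }
  assert (E2 : Rpower (rhobar + r x) (-1) = / (rhobar + r x)).
  { replace (-1) with (- (1)) by ring.
    rewrite Rpower_Ropp, Rpower_1 by exact Hp; reflexivity. }
  rewrite E1, E2; field; lra.
Qed.

Lemma solution_equations (L gamma B0 rhobar Bbar : R) (rho_init B_init : R -> R)
    (T : Rbar) (rho B : R -> R -> R) :
  gamma <> 0 -> smooth_solution L gamma B0 rho_init B_init T rho B ->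
  forall t, 0 < t -> Rbar_lt t T ->
  let r := fun x => rho t x - rhobar in
  let b := fun x => B t x - Bbar in
  (fun y => Derive (fun tau => rho tau y - rhobar) t)
    = Derive (flux_rho gamma rhobar Bbar r b) /\
  (fun y => Derive (fun tau => B tau y - Bbar) t)
    = Derive (flux_B gamma B0 rhobar Bbar r b).
Proof.
  intros Hg (_ & Hr & Hb & _ & Hpos & _ & Heq) t Ht HT r b.
  assert (HL : in_lifespan T t) by (split; [lra|exact HT]).
  assert (Sr : smooth r)
    by (apply smooth_minus_const; eapply smooth_on_lifespan_slice; eassumption).
  assert (Sb : smooth b)
    by (apply smooth_minus_const; eapply smooth_on_lifespan_slice; eassumption).
  assert (Er : forall x, rhobar + r x = rho t x) by (intros; unfold r; ring).
  assert (Eb : forall x, Bbar + b x = B t x) by (intros; unfold b; ring).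
  assert (Hp : forall x, 0 < rhobar + r x) by (intros; rewrite Er; apply Hpos, HL).
  assert (EP : Derive (fun z => total_pressure gamma rho B t z)
               = flux_rho gamma rhobar Bbar r b).
  { rewrite <- Derive_total_pressure by assumption; f_equal.
    apply functional_extensionality; intros z; unfold total_pressure.
    rewrite Er, Eb; reflexivity. }
  assert (Eshift : forall (f : R -> R) c, Derive (fun y => f y - c) = Derive f).
  { intros f c; rewrite <- (Derive_plus_const (- c) f); f_equal.
    apply functional_extensionality; intros; ring. }
  split; apply functional_extensionality; intros y; rewrite Eshift;
    destruct (Heq t y Ht HT) as [HR HB].
  - unfold rho_equation in HR; rewrite HR.
    change (Derive_n (fun y => total_pressure gamma rho B t y) 2 y)
      with (Derive (Derive (fun z => total_pressure gamma rho B t z)) y).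
    rewrite EP; reflexivity.
  - unfold B_equation in HB; rewrite HB, EP.
    apply Derive_ext; intros z.
    rewrite <- (flux_B_eq gamma B0 rhobar Bbar r b z (Hp z)), Er, Eb.
    f_equal; f_equal; unfold b.
    rewrite Eshift; reflexivity.
Qed.

Lemma solution_mean_conserved (L gamma B0 rhobar Bbar : R) (rho_init B_init : R -> R)
    (T : Rbar) (rho B : R -> R -> R) :
  0 < L -> gamma <> 0 -> smooth_solution L gamma B0 rho_init B_init T rho B ->
  RInt (fun x => rho_init x - rhobar) 0 L = 0 ->
  RInt (fun x => B_init x - Bbar) 0 L = 0 ->
  forall t, in_lifespan T t ->
  RInt (fun x => rho t x - rhobar) 0 L = 0 /\ RInt (fun x => B t x - Bbar) 0 L = 0.
Proof.
  intros HL Hg Hsol Mr Mb t Ht.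
  assert (Heq := solution_equations L gamma B0 rhobar Bbar _ _ T rho B Hg Hsol).
  destruct Hsol as (HT & Hr & Hb & Hper & Hpos & Hinit & _).
  assert (Hflux : forall t, 0 < t -> Rbar_lt t T ->
    let r := fun x => rho t x - rhobar in
    let b := fun x => B t x - Bbar in
    smooth r /\ smooth b /\ torus_periodic L r /\ torus_periodic L b /\
    (forall x, 0 < rhobar + r x)).
  { intros u Hu HuT r b.
    assert (Hl : in_lifespan T u) by (split; [lra|exact HuT]).
    split; [|split; [|split; [|split]]].
    - apply smooth_minus_const; eapply smooth_on_lifespan_slice; eassumption.
    - apply smooth_minus_const; eapply smooth_on_lifespan_slice; eassumption.
    - intros x; unfold r; rewrite (proj1 (Hper u Hl)); reflexivity.
    - intros x; unfold b; rewrite (proj2 (Hper u Hl)); reflexivity.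
    - intros x; unfold r; assert (P := Hpos u x Hl); lra. }
  split.
  - eapply eq_trans; [|exact Mr]; eapply eq_trans.
    + apply (smooth_on_lifespan_integral T L (fun t x => rho t x - rhobar) HL
               (smooth_on_lifespan_plus_const T rhobar rho Hr)) with (2 := Ht).
      intros u Hu HuT; rewrite (proj1 (Heq u Hu HuT)).
      destruct (Hflux u Hu HuT) as (Sr & Sb & Pr & Pb & Hp).
      apply RInt_Derive_periodic; [apply flux_rho_smooth|apply flux_rho_periodic]; assumption.
    + f_equal; apply functional_extensionality; intros x; rewrite (proj1 (Hinit x)); reflexivity.
  - eapply eq_trans; [|exact Mb]; eapply eq_trans.
    + apply (smooth_on_lifespan_integral T L (fun t x => B t x - Bbar) HL
               (smooth_on_lifespan_plus_const T Bbar B Hb)) with (2 := Ht).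
      intros u Hu HuT; rewrite (proj2 (Heq u Hu HuT)).
      destruct (Hflux u Hu HuT) as (Sr & Sb & Pr & Pb & Hp).
      apply RInt_Derive_periodic; [apply flux_B_smooth|apply flux_B_periodic]; assumption.
    + f_equal; apply functional_extensionality; intros x; rewrite (proj2 (Hinit x)); reflexivity.
Qed.

Lemma continuity_pt_sum_n (u : nat -> R -> R) (n : nat) (t : R) :
  (forall k, continuity_pt (u k) t) -> continuity_pt (fun x => sum_n (fun k => u k x) n) t.
Proof.
  intros H; induction n as [|n IH].
  - apply (continuity_pt_ext (u 0%nat)); [|apply H].
    intros x; rewrite sum_O; reflexivity.
  - apply (continuity_pt_ext (fun x => sum_n (fun k => u k x) n + u (S n) x)).
    + intros x; rewrite sum_Sn; reflexivity.
    + apply continuity_pt_plus; [exact IH|apply H].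
Qed.

Lemma solution_energy (m : nat) (L gamma B0 rhobar Bbar : R) (rho_init B_init : R -> R)
    (T : Rbar) (rho B : R -> R -> R) :
  0 < L -> gamma <> 0 -> smooth_solution L gamma B0 rho_init B_init T rho B ->
  let r := fun t x => rho t x - rhobar in
  let b := fun t x => B t x - Bbar in
  let E := fun t => energy L (Rpower rhobar (gamma - 2)) m (r (Rmax t 0)) (b (Rmax t 0)) in
  (forall t, in_lifespan T t -> continuity_pt E t) /\
  (forall t, 0 < t -> Rbar_lt t T ->
    is_derive E t (2 * sum_n (energy_flux L gamma B0 rhobar Bbar (r t) (b t)) m)).
Proof.
  intros HL Hg Hsol r b E.
  assert (Heq := solution_equations L gamma B0 rhobar Bbar _ _ T rho B Hg Hsol).
  destruct Hsol as (_ & Hr & Hb & _).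
  assert (Hr' : smooth_on_lifespan T r) by exact (smooth_on_lifespan_plus_const T rhobar rho Hr).
  assert (Hb' : smooth_on_lifespan T b) by exact (smooth_on_lifespan_plus_const T Bbar B Hb).
  assert (Ar := fun k => smooth_on_lifespan_l2sq T L r k HL Hr').
  assert (Ab := fun k => smooth_on_lifespan_l2sq T L b k HL Hb').
  split.
  - intros t Ht; unfold E, energy, sobolev_sq.
    apply continuity_pt_plus; [apply continuity_pt_mult|].
    + apply continuity_pt_const; intros x y; reflexivity.
    + apply continuity_pt_sum_n with
        (u := fun k x => l2sq L (Derive_n (r (Rmax x 0)) k)); intros k; apply Ar, Ht.
    + apply continuity_pt_sum_n with
        (u := fun k x => l2sq L (Derive_n (b (Rmax x 0)) k)); intros k; apply Ab, Ht.
  - intros t Ht HT.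
    destruct (Heq t Ht HT) as [Er Eb].
    set (dr := fun k => 2 * RInt (fun x => Derive_n (r t) k x
      * Derive_n (flux_rho gamma rhobar Bbar (r t) (b t)) (S k) x) 0 L).
    set (db := fun k => 2 * RInt (fun x => Derive_n (b t) k x
      * Derive_n (flux_B gamma B0 rhobar Bbar (r t) (b t)) (S k) x) 0 L).
    replace (2 * sum_n (energy_flux L gamma B0 rhobar Bbar (r t) (b t)) m)
      with (Rpower rhobar (gamma - 2) * sum_n dr m + sum_n db m).
    + unfold E, energy, sobolev_sq.
      apply (is_derive_plus (V := R_NormedModule)).
      * apply is_derive_scal.
        apply (is_derive_sum_n (fun k x => l2sq L (Derive_n (r (Rmax x 0)) k))).
        intros k _; unfold dr; rewrite Derive_n_succ.
        (* The third occurrence of [r] is the one under the time derivative, where the equation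
           applies. *)
        assert (K := proj2 (Ar k) t Ht HT); unfold r at 3 in K; rewrite Er in K; exact K.
      * apply (is_derive_sum_n (fun k x => l2sq L (Derive_n (b (Rmax x 0)) k))).
        intros k _; unfold db; rewrite Derive_n_succ.
        assert (K := proj2 (Ab k) t Ht HT); unfold b at 3 in K; rewrite Eb in K; exact K.
    + rewrite <- !sum_n_Rscal, <- sum_n_Rplus; apply sum_n_ext; intros k.
      unfold dr, db, energy_flux.
      match goal with |- ?x = ?y => change (@eq R x y) end; ring.
Qed.

Lemma sqrt_exp_decay (K E E0 c t : R) :
  0 <= K -> 0 <= E0 -> E <= E0 * exp (- c * t) ->
  sqrt (K * E) <= sqrt (K * E0) * exp (- (c / 2) * t).
Proof.
  intros HK H0 HE.
  assert (P := exp_pos (- (c / 2) * t)).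
  rewrite <- (sqrt_pow2 (exp (- (c / 2) * t))) by lra.
  rewrite <- sqrt_mult by (try apply pow2_ge_0; apply Rmult_le_pos; assumption).
  apply sqrt_le_1_alt.
  replace (exp (- (c / 2) * t) ^ 2) with (exp (- c * t)).
  - rewrite Rmult_assoc; apply Rmult_le_compat_l; assumption.
  - simpl; rewrite Rmult_1_r, <- exp_plus; f_equal; field.
Qed.

Lemma energy_le_norms (L alpha eps : R) (m : nat) (r b : R -> R) :
  0 < L -> 0 <= alpha -> smooth r -> smooth b ->
  sobolev_norm L m r + sobolev_norm L m b <= eps ->
  energy L alpha m r b <= (alpha + 1) * eps ^ 2.
Proof.
  intros HL Ha Sr Sb H.
  assert (Q1 := sobolev_sq_nonneg L m r HL Sr); assert (Q2 := sobolev_sq_nonneg L m b HL Sb).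
  change (sqrt (sobolev_sq L m r) + sqrt (sobolev_sq L m b) <= eps) in H.
  assert (P1 := sqrt_pos (sobolev_sq L m r)); assert (P2 := sqrt_pos (sobolev_sq L m b)).
  unfold energy; rewrite <- (pow2_sqrt _ Q1) at 1; rewrite <- (pow2_sqrt _ Q2).
  assert (sqrt (sobolev_sq L m r) ^ 2 <= eps ^ 2) by (apply pow_incr; lra).
  assert (sqrt (sobolev_sq L m b) ^ 2 <= eps ^ 2) by (apply pow_incr; lra).
  nra.
Qed.

Lemma energy_nonneg (L alpha : R) (m : nat) (r b : R -> R) :
  0 < L -> 0 <= alpha -> smooth r -> smooth b -> 0 <= energy L alpha m r b.
Proof.
  intros HL Ha Sr Sb; apply Rplus_le_le_0_compat; [apply Rmult_le_pos; [exact Ha|]|];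
    apply sobolev_sq_nonneg; assumption.
Qed.

Lemma Hnorm_of_nat (L : R) (m : nat) (f : R -> R) :
  Hnorm L (Z.of_nat m) f = sobolev_norm L m f.
Proof.
  rewrite <- (Nat2Z.id m) at 2; destruct (Z.of_nat m) eqn:E; try reflexivity; lia.
Qed.

Lemma deviation_of_mean (L c : R) (f : R -> R) :
  0 < L -> torus_smooth L f -> torus_mean L f = c ->
  smooth (fun x => f x - c) /\ torus_periodic L (fun x => f x - c) /\
  RInt (fun x => f x - c) 0 L = 0.
Proof.
  intros HL [Pf Sf] Hm; split; [apply smooth_minus_const; exact Sf|split].
  - intros x; rewrite Pf; reflexivity.
  - assert (E : RInt (fun x => f x + - c) 0 L = RInt f 0 L + (L - 0) * - c).
    { rewrite <- RInt_Rconst; apply RInt_Rplus; intros x;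
        [apply smooth_continuous; exact Sf|apply continuous_const]. }
    eapply eq_trans; [exact E|]; rewrite <- Hm; unfold torus_mean.
    set (I0 := RInt f 0 L : R).
    match goal with |- ?x = ?y => change (@eq R x y) end; field; lra.
Qed.

(** The constants do not depend on the lifespan: this uniformity first excludes blow-up at a finite
    T and then gives the limits. D is left unspecified at each time, as only N is used
    afterwards. *)
Lemma solution_decay (p : nat) (L gamma B0 rhobar Bbar : R) :
  0 < L -> (1 <= p)%nat -> gamma <> 0 -> B0 <> 0 -> 0 < rhobar ->
  exists eps c A, 0 < eps /\ 0 < c /\ forall rho_init B_init,
    torus_smooth L rho_init -> torus_smooth L B_init ->
    sobolev_norm L (S p) (fun x => rho_init x - rhobar)
      + sobolev_norm L (S p) (fun x => B_init x - Bbar) <= eps ->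
    torus_mean L rho_init = rhobar -> torus_mean L B_init = Bbar ->
    (forall x, 0 < rho_init x) /\
    forall T rho B, smooth_solution L gamma B0 rho_init B_init T rho B ->
    forall t, in_lifespan T t -> exists N D, N <= A * exp (- c * t) /\
      near p rhobar N D (fun x => rho t x - rhobar) (fun x => B t x - Bbar).
Proof.
  intros HL Hp Hg HB H0.
  destruct (energy_estimate p L gamma B0 rhobar Bbar HL Hp HB H0)
    as (delta & c & K & Hdelta & Hc & HK & H).
  set (alpha := Rpower rhobar (gamma - 2)) in *.
  assert (Ha : 0 < alpha) by apply exp_pos.
  (* eps <= 1 gives eps^2 <= eps; the other bound then makes the initial energy at most delta / 2,
     strictly below the bootstrap threshold. *)
  set (eps := Rmin 1 (delta / (2 * (alpha + 1)))).
  assert (Heps : 0 < eps) by (apply Rmin_glb_lt; [lra|apply Rdiv_lt_0_compat; lra]).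
  assert (Heps2 : (alpha + 1) * eps ^ 2 <= delta / 2).
  { assert (E1 : eps <= 1) by apply Rmin_l.
    assert (E2 : eps <= delta / (2 * (alpha + 1))) by apply Rmin_r.
    apply Rle_trans with ((alpha + 1) * eps); [apply Rmult_le_compat_l; nra|].
    apply Rle_trans with ((alpha + 1) * (delta / (2 * (alpha + 1))));
      [apply Rmult_le_compat_l; lra|right; field; lra]. }
  exists eps, (c / 2), (sqrt (K * (delta / 2))).
  split; [exact Heps|split; [lra|]].
  intros rho_init B_init Hri Hbi Hsmall Hmr Hmb.
  destruct (deviation_of_mean L rhobar rho_init HL Hri Hmr) as (Sr0 & Pr0 & Mr0).
  destruct (deviation_of_mean L Bbar B_init HL Hbi Hmb) as (Sb0 & Pb0 & Mb0).
  assert (HE0 := energy_le_norms L alpha eps (S p) _ _ HL (Rlt_le _ _ Ha) Sr0 Sb0 Hsmall).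
  split.
  (* Positivity is read off the data alone, before any solution is considered: [near] forces |r| <=
     rhobar / 2. *)
  { destruct (H _ _ Sr0 Sb0 Pr0 Pb0 Mr0 Mb0) as [[D Hn] _]; [lra|].
    intros x; destruct (near_pos _ _ _ _ _ _ H0 Hn x) as [_ P]; lra. }
  intros T rho B Hsol t Ht.
  assert (Hmean := solution_mean_conserved L gamma B0 rhobar Bbar _ _ T rho B HL Hg Hsol Mr0 Mb0).
  destruct (solution_energy (S p) L gamma B0 rhobar Bbar _ _ T rho B HL Hg Hsol) as [HCont HDer].
  fold alpha in HCont, HDer.
  destruct Hsol as (HT & Hr & Hb & Hper & Hpos & Hinit & _).
  set (r := fun t x => rho t x - rhobar) in *.
  set (b := fun t x => B t x - Bbar) in *.
  set (E := fun t => energy L alpha (S p) (r (Rmax t 0)) (b (Rmax t 0))) in *.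
  assert (Reg : forall u, in_lifespan T u -> smooth (r u) /\ smooth (b u) /\
    torus_periodic L (r u) /\ torus_periodic L (b u)).
  { intros u Hu; destruct (Hper u Hu) as [P1 P2].
    split; [|split; [|split]].
    - apply smooth_minus_const; eapply smooth_on_lifespan_slice; eassumption.
    - apply smooth_minus_const; eapply smooth_on_lifespan_slice; eassumption.
    - intros x; unfold r; rewrite P1; reflexivity.
    - intros x; unfold b; rewrite P2; reflexivity. }
  assert (EE : forall u, 0 <= u -> E u = energy L alpha (S p) (r u) (b u)).
  { intros u Hu; unfold E; rewrite Rmax_left by exact Hu; reflexivity. }
  assert (EI : E 0 <= delta / 2).
  { rewrite EE by lra.
    replace (r 0) with (fun x => rho_init x - rhobar)
      by (apply functional_extensionality; intros x; unfold r; rewrite (proj1 (Hinit x)); reflexivity).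
    replace (b 0) with (fun x => B_init x - Bbar)
      by (apply functional_extensionality; intros x; unfold b; rewrite (proj2 (Hinit x)); reflexivity).
    lra. }
  assert (Epos : forall u, in_lifespan T u -> 0 <= E u).
  { intros u Hu; rewrite EE by apply Hu; destruct (Reg u Hu) as (S1 & S2 & _).
    apply energy_nonneg; try assumption; lra. }
  destruct (bootstrap_decay T E delta c Hc HCont Epos) with (t := t) as [B1 B2].
  - intros u Hu HuT HEu.
    assert (Hlu : in_lifespan T u) by (split; [lra|exact HuT]).
    eexists; split; [apply HDer; assumption|].
    destruct (Reg u Hlu) as (S1 & S2 & P1 & P2); destruct (Hmean u Hlu) as [M1 M2].
    rewrite EE in HEu |- * by lra.
    apply (H (r u) (b u)); assumption.
  - lra.
  - exact Ht.
  - destruct (Reg t Ht) as (S1 & S2 & P1 & P2); destruct (Hmean t Ht) as [M1 M2].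
    rewrite EE in B1, B2 by apply Ht.
    destruct (H (r t) (b t) S1 S2 P1 P2 M1 M2 B1) as [[D Hn] _].
    eexists; exists D; split; [|exact Hn].
    apply sqrt_exp_decay; [lra|lra|].
    eapply Rle_trans; [exact B2|].
    apply Rmult_le_compat_r; [apply Rlt_le, exp_pos|exact EI].
Qed.

(** * Global existence and convergence *)

Lemma no_blowup (L T0 M : R) (f : R -> R) :
  0 < T0 -> (forall t, 0 <= t < T0 -> f t <= M) ->
  ~ filterlim f (at_left T0) (Rbar_locally p_infty).
Proof.
  intros HT Hf Hlim.
  assert (H1 : at_left T0 (fun t => M < f t)).
  { apply Hlim; exists M; intros; assumption. }
  assert (H2 : at_left T0 (fun t => 0 < t < T0)).
  { exists (mkposreal T0 HT); intros y Hy Hlt; change (Rabs (y - T0) < T0) in Hy.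
    apply Rabs_lt_between in Hy; lra. }
  destruct (filter_ex _ (filter_and _ _ H1 H2)) as (t & Ht1 & Ht2).
  assert (f t <= M) by (apply Hf; lra); lra.
Qed.

Lemma dbound_const_plus (n : nat) (M c : R) (f : R -> R) :
  smooth f -> dbound n M f -> dbound n (Rabs c + M) (fun x => c + f x).
Proof. intros Sf Hf; apply dbound_plus; [smooth_tac|smooth_tac|apply dbound_const|exact Hf]. Qed.

(** After division by the positive density, the first and third components are put in the shape
    required by [flux_combination_dbound], whence the explicit factors -1 and the term with
    coefficient 0. *)
Lemma velocity_formula (gamma B0 rhobar Bbar : R) (rho B ux uy uz : R -> R -> R) (t : R) :
  (forall x, 0 < rho t x) -> (forall x, velocity gamma B0 rho B ux uy uz t x) ->
  let r := fun x => rho t x - rhobar in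
  let b := fun x => B t x - Bbar in
  ux t = (fun x =>
    -1 * (Rpower (rhobar + r x) (-1) * Rpower (rhobar + r x) (gamma - 1)) * Derive r x
    + -1 * (Rpower (rhobar + r x) (-1) * (Bbar + b x)) * Derive b x) /\
  uy t = (fun _ => 0) /\
  uz t = (fun x => 0 * Derive r x + B0 * Rpower (rhobar + r x) (-1) * Derive b x).
Proof.
  intros Hp Hu r b.
  assert (Er : forall x, rhobar + r x = rho t x) by (intros; unfold r; ring).
  assert (Eb : forall x, Bbar + b x = B t x) by (intros; unfold b; ring).
  assert (Dr : Derive r = Derive (rho t)).
  { rewrite <- (Derive_plus_const rhobar r); f_equal.
    apply functional_extensionality, Er. }
  assert (Db : Derive b = Derive (B t)).
  { rewrite <- (Derive_plus_const Bbar b); f_equal.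
    apply functional_extensionality, Eb. }
  assert (Ei : forall x, Rpower (rho t x) (-1) = / rho t x).
  { intros x; replace (-1) with (- (1)) by ring.
    rewrite Rpower_Ropp, Rpower_1 by apply Hp; reflexivity. }
  rewrite Dr, Db.
  split; [|split]; apply functional_extensionality; intros x;
    destruct (Hu x) as (H1 & H2 & H3); assert (P := Hp x);
    apply Rmult_eq_reg_l with (rho t x); try lra.
  - rewrite H1, Er, Ei, Eb.
    change (Derive (fun y => rho t y) x) with (Derive (rho t) x).
    change (Derive (fun y => B t y) x) with (Derive (B t) x); field; lra.
  - rewrite H3, Er, Ei.
    change (Derive (fun y => B t y) x) with (Derive (B t) x); field; lra.
Qed.

Theorem theorem2 (L gamma B0 rhobar Bbar : R) (s : nat)
  (hL : 0 < L) (hgamma : 1 < gamma < 2) (hB0 : B0 <> 0)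
  (hrhobar : 0 < rhobar) (hs : (6 <= s)%nat) :
  exists eps : R, 0 < eps /\
  forall rho_init B_init : R -> R,
    torus_smooth L rho_init -> torus_smooth L B_init ->
    Hnorm L (Z.of_nat s) (fun x => rho_init x - rhobar)
      + Hnorm L (Z.of_nat s) (fun x => B_init x - Bbar) <= eps ->
    torus_mean L rho_init = rhobar ->
    torus_mean L B_init = Bbar ->
    (forall x, 0 < rho_init x) /\
    forall (T : Rbar) (rho B : R -> R -> R),
      maximal_smooth_solution L gamma B0 rho_init B_init T rho B ->
      T = p_infty /\
      forall m : nat, (m < s)%nat ->
        is_lim (fun t => Hnorm L (Z.of_nat m) (fun x => rho t x - rhobar))
          p_infty 0 /\
        is_lim (fun t => Hnorm L (Z.of_nat m) (fun x => B t x - Bbar))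
          p_infty 0 /\
        forall ux uy uz : R -> R -> R,
          (forall t x, 0 <= t -> velocity gamma B0 rho B ux uy uz t x) ->
          is_lim (fun t => Hnorm L (Z.of_nat m - 1) (ux t)) p_infty 0 /\
          is_lim (fun t => Hnorm L (Z.of_nat m - 1) (uy t)) p_infty 0 /\
          is_lim (fun t => Hnorm L (Z.of_nat m - 1) (uz t)) p_infty 0.
Proof.
  (* With s = q + 2 and p = q + 1 the energy lives at order s, the sup bounds on the deviations
     reach order q + 1, and those on the velocity order q. *)
  destruct s as [|[|q]]; [lia|lia|].
  assert (Hg : gamma <> 0) by lra.
  destruct (solution_decay (S q) L gamma B0 rhobar Bbar hL ltac:(lia) Hg hB0 hrhobar)
    as (eps & c & A & Heps & Hc & H).
  assert (Hinv := admissible_Rpower (S q) rhobar (-1) hrhobar).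
  destruct (flux_combination_dbound q rhobar _ _ _ _
    (admissible_mult _ _ _ _ _ _ (admissible_const (S q) rhobar (-1))
      (admissible_mult _ _ _ _ _ _ Hinv (admissible_Rpower (S q) rhobar (gamma - 1) hrhobar)))
    (admissible_mult _ _ _ _ _ _ (admissible_const (S q) rhobar (-1))
      (admissible_mult _ _ _ _ _ _ Hinv (admissible_B (S q) rhobar Bbar))))
    as (Cx & HCx & Hx).
  destruct (flux_combination_dbound q rhobar _ _ _ _
    (admissible_const (S q) rhobar 0)
    (admissible_mult _ _ _ _ _ _ (admissible_const (S q) rhobar B0) Hinv))
    as (Cz & HCz & Hz).
  exists eps; split; [exact Heps|].
  intros rho_init B_init Hri Hbi Hsmall Hmr Hmb.
  rewrite !Hnorm_of_nat in Hsmall.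
  destruct (H rho_init B_init Hri Hbi Hsmall Hmr Hmb) as [Hpos Hdec].
  split; [exact Hpos|].
  intros T rho B (Hsol & _ & Hblow).
  specialize (Hdec T rho B Hsol).
  destruct Hsol as (HT & _ & _ & _ & Hrpos & _).
  assert (HTinf : T = p_infty).
  { destruct T as [T0| |]; [exfalso|reflexivity|contradiction].
    set (M := sqrt (INR (S (S q)) * L)).
    (* The bound N <= 1 holds at all times before T0 and 3 <= q + 1, so the H^3 norms stay bounded;
       the equilibrium constants add their own share, since the criterion concerns rho and B and not
       their deviations. *)
    apply (no_blowup L T0 (M * (Rabs rhobar + 1) + M * (Rabs Bbar + 1))
             (fun t => Hnorm L 3 (rho t) + Hnorm L 3 (B t)) HT);
      [|exact (Hblow T0 eq_refl)].
    intros t Ht.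
    destruct (Hdec t (conj (proj1 Ht) (proj2 Ht))) as (N & D & _ & Hn).
    destruct Hn as (HN & _ & _ & Sr & Sb & R1 & _ & B1 & _).
    assert (K : forall d f, smooth (fun x => f x - d) -> dbound (S q) N (fun x => f x - d) ->
      Hnorm L 3 f <= M * (Rabs d + 1)).
    { intros d f Sf Df.
      replace f with (fun x => d + (f x - d))
        by (apply functional_extensionality; intros; ring).
      apply Hnorm_le; [exact hL|lia| |].
      - apply (smooth_plus (fun _ => d)); [apply smooth_const|exact Sf].
      - apply (dbound_const_plus (S q) 1 d (fun x => f x - d) Sf).
        apply dbound_le with (3 := Df); [lia|lra]. }
    apply Rplus_le_compat; apply K; assumption. }
  split; [exact HTinf|]; subst T.
  assert (Hlife : forall t, 0 <= t -> in_lifespan p_infty t)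
    by (intros; split; [assumption|exact I]).
  (* Whatever is bounded by C N up to order n tends to 0 in H^z for z <= n. The deviations use n = q
     + 1, the velocity n = q, where m < s gives m - 1 <= q. *)
  assert (Lim : forall (n : nat) (z : Z) (C : R) (f : R -> R -> R),
    (-1 <= z <= Z.of_nat n)%Z -> 0 <= C ->
    (forall t N D, 0 <= t ->
       near (S q) rhobar N D (fun x => rho t x - rhobar) (fun x => B t x - Bbar) ->
       smooth (f t) /\ dbound n (C * N) (f t)) ->
    is_lim (fun t => Hnorm L z (f t)) p_infty 0).
  { intros n z C f Hz' HC Hf.
    apply (is_lim_0_of_exp_bound _ (sqrt (INR (S n) * L) * (C * A)) c Hc).
    intros t Ht; destruct (Hdec t (Hlife t Ht)) as (N & D & HNA & Hn).
    destruct (Hf t N D Ht Hn) as [Sf Df].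
    destruct (Hnorm_le L (C * N) n z (f t) hL Hz' Sf Df) as [H1 H2].
    split; [exact H1|]; eapply Rle_trans; [exact H2|].
    rewrite !Rmult_assoc; apply Rmult_le_compat_l; [apply sqrt_pos|].
    apply Rmult_le_compat_l; assumption. }
  intros m Hm; split; [|split].
  - apply (Lim (S q) _ 1); [lia|lra|].
    intros t N D _ (_ & _ & _ & Sr & _ & R1 & _); rewrite Rmult_1_l; split; assumption.
  - apply (Lim (S q) _ 1); [lia|lra|].
    intros t N D _ (_ & _ & _ & _ & Sb & _ & _ & B1 & _); rewrite Rmult_1_l; split; assumption.
  - intros ux uy uz Hvel.
    assert (V := fun t (Ht : 0 <= t) => velocity_formula gamma B0 rhobar Bbar rho B ux uy uz t
      (fun x => Hrpos t x (Hlife t Ht)) (fun x => Hvel t x Ht)).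
    split; [|split].
    + apply (Lim q _ Cx); [lia|exact HCx|].
      intros t N D Ht Hn; destruct (V t Ht) as (-> & _); exact (Hx N D _ _ Hn).
    + apply (Lim q _ 0); [lia|lra|].
      intros t N D Ht Hn; destruct (V t Ht) as (_ & -> & _).
      rewrite Rmult_0_l; split; [apply smooth_const|].
      apply dbound_le with (3 := dbound_const q 0); [lia|rewrite Rabs_R0; lra].
    + apply (Lim q _ Cz); [lia|exact HCz|].
      intros t N D Ht Hn; destruct (V t Ht) as (_ & _ & ->); exact (Hz N D _ _ Hn).
Qed.
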